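(* Let $K_1,\dots,K_N$ be distinct complex numbers and let $\boldsymbol\lambda$ be a partition of $n$ with at most $N$ parts. With the notation of the context, the map $\mu_{\boldsymbol\lambda}:\mathcal O_{\boldsymbol\lambda}\to\mathcal M_{\boldsymbol\lambda}$, $F\mapsto\tau_{\boldsymbol\lambda}(F)v$, is an isomorphism of vector spaces. This isomorphism preserves the degree of elements. The maps $\tau_{\boldsymbol\lambda}$ and $\mu_{\boldsymbol\lambda}$ intertwine the action of multiplication operators on $\mathcal O_{\boldsymbol\lambda}$ and the action of the Bethe algebra $\mathcal B_{\boldsymbol\lambda}$ on $\mathcal M_{\boldsymbol\lambda}$, that is, for any $F,G\in\mathcal O_{\boldsymbol\lambda}$, $$\mu_{\boldsymbol\lambda}(FG)=\tau_{\boldsymbol\lambda}(F)\,\mu_{\boldsymbol\lambda}(G).$$ In other words, $\tau_{\boldsymbol\lambda}$ and $\mu_{\boldsymbol\lambda}$ give an isomorphism of the regular representation of $\mathcal O_{\boldsymbol\lambda}$ and the $\mathcal B_{\boldsymbol\lambda}$-module $\mathcal M_{\boldsymbol\lambda}$.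
   Context: **Bethe algebra.** Let $e_{ij}$, $i,j=1,\dots,N$, be the standard generators of $\mathfrak{gl}_N$, $[e_{ij},e_{sk}]=\delta_{js}e_{ik}-\delta_{ik}e_{sj}$. Let $\mathfrak{gl}_N[t]=\mathfrak{gl}_N\otimes\mathbb C[t]$ with pointwise bracket; $\mathfrak{gl}_N$ is identified with $\mathfrak{gl}_N\otimes 1$. For $g\in\mathfrak{gl}_N$ put $g(u)=\sum_{r\ge0}(g\otimes t^r)u^{-r-1}$. For an $N\times N$ matrix $A=(a_{ij})$ with possibly noncommuting entries, $\operatorname{rdet}A=\sum_{\sigma\in S_N}(-1)^\sigma a_{1\sigma(1)}\cdots a_{N\sigma(N)}$. Let $\partial=d/du$ and $$\mathcal D^{\mathcal B}=\operatorname{rdet}\bigl(\delta_{ij}(\partial-K_i)-e_{ji}(u)\bigr)_{i,j=1}^N=\partial^N+\sum_{i=1}^N B_i(u)\partial^{N-i},\qquad B_i(u)=\sum_{j\ge0}B_{ij}u^{-j},\quad B_{ij}\in U(\mathfrak{gl}_N[t]).$$ The Bethe algebra $\mathcal B$ is the unital subalgebra of $U(\mathfrak{gl}_N[t])$ generated by all $B_{ij}$, $i=1,\dots,N$, $j\ge0$. It is commutative and commutes with all $e_{ii}$, so it preserves weight subspaces $(M)_{\boldsymbol\lambda}=\{v\in M: e_{ii}v=\lambda_iv,\ i=1,\dots,N\}$ of any $\mathfrak{gl}_N[t]$-module $M$. **The module.** $V=\mathbb C^N$ is the vector representation of $\mathfrak{gl}_N$. Let $\mathcal V=V^{\otimes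 n}\otimes\mathbb C[z_1,\dots,z_n]$, with $g\otimes t^r$ acting by $\sum_{s=1}^n z_s^r g^{(s)}$ ($g^{(s)}$ is $g$ acting on the $s$-th tensor factor). $S_n$ acts on $\mathcal V$ by permuting the tensor factors and the variables simultaneously: $\sigma(p(z_1,\dots,z_n)v_1\otimes\cdots\otimes v_n)=p(z_{\sigma(1)},\dots,z_{\sigma(n)})v_{\sigma^{-1}(1)}\otimes\cdots\otimes v_{\sigma^{-1}(n)}$. The space of invariants $\mathcal V^S$ is a $\mathfrak{gl}_N[t]$-submodule, graded by $\deg z_i=1$ and $\deg V^{\otimes n}=0$. Put $\mathcal M_{\boldsymbol\lambda}=(\mathcal V^S)_{\boldsymbol\lambda}$, let $\mathcal B_{\boldsymbol\lambda}$ be the image of $\mathcal B$ in $\operatorname{End}(\mathcal M_{\boldsymbol\lambda})$, and let $\hat B_{ij}\in\mathcal B_{\boldsymbol\lambda}$ be the image of $B_{ij}$. **The algebra $\mathcal O_{\boldsymbol\lambda}$.** A partition of $n$ with at most $N$ parts is $\boldsymbol\lambda=(\lambda_1\ge\cdots\ge\lambda_N\ge0)$, integers with sum $n$. $\mathcal O_{\boldsymbol\lambda}$ is the polynomial algebra over $\mathbb C$ in variables $f_{ij}$, $i=1,\dots,N$, $j=1,\dots,\lambda_i$, graded by $\deg f_{ij}=j$. Put $$f_i(u)=e^{K_iu}\bigl(u^{\lambda_i}+f_{i1}u^{\lambda_i-1}+\cdots+f_{i\lambda_i}\bigr),\quad i=1,\dots,N,$$ and $\operatorname{Wr}(g_1,\dots,g_N)=\det\bigl(g_i^{(j-1)}\bigr)_{i,j=1}^N$.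 Define $$\mathcal D^{\mathcal O}_{\boldsymbol\lambda}=\frac1{\operatorname{Wr}(f_1,\dots,f_N)}\operatorname{rdet}\begin{pmatrix} f_1&f_1'&\cdots&f_1^{(N)}\\ \vdots&\vdots&&\vdots\\ f_N&f_N'&\cdots&f_N^{(N)}\\ 1&\partial&\cdots&\partial^N\end{pmatrix}=\partial^N+\sum_{i=1}^NF_i(u)\partial^{N-i},$$ where (expanding at $u=\infty$) $F_i(u)=\sum_{j\ge0}F_{ij}u^{-j}$ with $F_{ij}\in\mathcal O_{\boldsymbol\lambda}$. **The maps.** $\tau_{\boldsymbol\lambda}:\mathcal O_{\boldsymbol\lambda}\to\mathcal B_{\boldsymbol\lambda}$ is the algebra isomorphism with $\tau_{\boldsymbol\lambda}(F_{ij})=\hat B_{ij}$ for all $i,j$. The vector $v\in\mathcal M_{\boldsymbol\lambda}$ is a fixed nonzero element of degree $0$ (unique up to a nonzero scalar), and $\mu_{\boldsymbol\lambda}(F)=\tau_{\boldsymbol\lambda}(F)v$. The degree of a nonzero, not necessarily homogeneous element of $\mathcal O_{\boldsymbol\lambda}$ or $\mathcal M_{\boldsymbol\lambda}$ is the largest degree of its nonzero homogeneous components. *)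

(* Defs.v *)
From HB Require Import structures.
From mathcomp Require Import all_boot all_order all_algebra perm.
From mathcomp Require Import boolp reals complex mpoly.

Set Implicit Arguments.
Unset Strict Implicit.
Unset Printing Implicit Defensive.

Import GRing.Theory Num.Theory.
Local Open Scope ring_scope.
Local Open Scope quotient_scope.

Record series (A : nzRingType) := Series { scoef :> nat -> A }.

HB.instance Definition _ (A : nzRingType) := gen_eqMixin (series A).
HB.instance Definition _ (A : nzRingType) := gen_choiceMixin (series A).

Section SeriesRing.
Variable A : nzRingType.
Implicit Types f g h : series A.

Lemma seriesP f g : (forall k, f k = g k) -> f = g.
Proof. by case: f => f; case: g => g /= fg; congr Series; apply/funext. Qed.

Definition series_add f g := Series (fun k => f k + g k).
Definition series_opp f := Series (fun k => - f k).
Definition series_const (a : A) := Series (fun k => if k == 0%N then a else 0).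
Definition series_mul f g := Series (fun k => \sum_(j < k.+1) f j * g (k - j)%N).

Fact series_addA : associative series_add.
Proof. by move=> f g h; apply: seriesP => k /=; rewrite addrA. Qed.
Fact series_addC : commutative series_add.
Proof. by move=> f g; apply: seriesP => k /=; rewrite addrC. Qed.
Fact series_add0 : left_id (series_const 0) series_add.
Proof. by move=> f; apply: seriesP => k /=; rewrite if_same add0r. Qed.
Fact series_addN : left_inverse (series_const 0) series_opp series_add.
Proof. by move=> f; apply: seriesP => k /=; rewrite if_same addNr. Qed.

HB.instance Definition _ := GRing.isZmodule.Build (series A)
  series_addA series_addC series_add0 series_addN.

Let trunc n f : {poly A} := \poly_(j < n) f j.

Let series_mulE n f g k : (k < n)%N ->
  series_mul f g k = (trunc n f * trunc n g)`_k.
Proof.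
move=> kn; rewrite coefM /=; apply: eq_bigr => j _; rewrite !coef_poly.
have jk : (j <= k)%N by rewrite -ltnS.
by rewrite (leq_ltn_trans jk kn) (leq_ltn_trans (leq_subr _ _) kn).
Qed.

Fact series_mulA : associative series_mul.
Proof.
move=> f g h; apply: seriesP => k.
have low (p q q' : {poly A}) : (forall j, (j <= k)%N -> q`_j = q'`_j) ->
    ((p * q)`_k = (p * q')`_k) * ((q * p)`_k = (q' * p)`_k :> A).
  move=> qq'; split; rewrite !coefM; apply: eq_bigr => j _; rewrite qq' //.
    exact: leq_subr.
  by rewrite -ltnS.
rewrite !(@series_mulE k.+1) //.
have tm f1 f2 j : (j <= k)%N ->
    (trunc k.+1 (series_mul f1 f2))`_j = (trunc k.+1 f1 * trunc k.+1 f2)`_j.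
  by move=> jk; rewrite coef_poly ltnS jk; apply: series_mulE.
rewrite (low _ _ _ (tm g h)).1 (low _ _ _ (tm f g)).2.
by rewrite mulrA.
Qed.

Fact series_mul1 : left_id (series_const 1) series_mul.
Proof.
move=> f; apply: seriesP => k /=.
rewrite big_ord_recl big1 ?mul1r ?subn0 ?addr0 // => i _.
by rewrite mul0r.
Qed.

Fact series_mulr1 : right_id (series_const 1) series_mul.
Proof.
move=> f; apply: seriesP => k /=; rewrite big_ord_recr big1 /=.
  by rewrite subnn mulr1 add0r.
by move=> i _; rewrite subn_eq0 leqNgt ltn_ord mulr0.
Qed.

Fact series_mulDl : left_distributive series_mul +%R.
Proof.
move=> f g h; apply: seriesP => k /=; rewrite -big_split /=.
by apply: eq_bigr => j _; rewrite mulrDl.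
Qed.

Fact series_mulDr : right_distributive series_mul +%R.
Proof.
move=> f g h; apply: seriesP => k /=; rewrite -big_split /=.
by apply: eq_bigr => j _; rewrite mulrDr.
Qed.

Fact series_1neq0 : series_const 1 != 0.
Proof.
apply/eqP => /(congr1 (fun f : series A => f 0%N)) /= /eqP.
by rewrite oner_eq0.
Qed.

HB.instance Definition _ := GRing.Zmodule_isNzRing.Build (series A)
  series_mulA series_mul1 series_mulr1 series_mulDl series_mulDr series_1neq0.

Lemma series_addE f g k : (f + g) k = f k + g k. Proof. by []. Qed.
Lemma series_mulEl f g k : (f * g) k = \sum_(j < k.+1) f j * g (k - j)%N.
Proof. by []. Qed.
Lemma series_mulEr f g k : (f * g) k = \sum_(j < k.+1) f (k - j)%N * g j.
Proof.
rewrite series_mulEl (reindex_inj rev_ord_inj) /=; apply: eq_bigr => j _.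
by rewrite subSS subKn // -ltnS.
Qed.

End SeriesRing.

Section SeriesCom.
Variable A : comNzRingType.

Fact series_mulC : commutative (@series_mul A).
Proof.
move=> f g; apply: seriesP => k.
rewrite [LHS]series_mulEl [RHS]series_mulEr.
by apply: eq_bigr => j _; rewrite mulrC.
Qed.

HB.instance Definition _ := GRing.PzRing_hasCommutativeMul.Build (series A)
  series_mulC.
End SeriesCom.

Definition poly_series (A : nzRingType) (p : {poly A}) := Series (fun k => p`_k).

Record derivation (S : nzRingType) := Derivation {
  der_fun :> S -> S;
  derD : {morph der_fun : f g / f + g};
  derM : forall f g, der_fun (f * g) = der_fun f * g + f * der_fun g }.

Section SeriesDerivations.
Variable A : nzRingType.
Implicit Types f g : series A.

(* d/du of sum_k f_k u^k *)
Definition dser f := Series (fun k => f k.+1 *+ k.+1).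

(* d/du of sum_k f_k u^-k, that is, -x^2 d/dx for the variable x = u^-1 *)
Definition dinv f := Series (fun k => - (f k.-1 *+ k.-1)).

Fact dserD : {morph dser : f g / f + g}.
Proof. by move=> f g; apply: seriesP => k /=; rewrite mulrnDl. Qed.

Fact dinvD : {morph dinv : f g / f + g}.
Proof. by move=> f g; apply: seriesP => k /=; rewrite mulrnDl opprD. Qed.

Let eulerM f g k : (f * g) k *+ k =
  \sum_(j < k.+1) (f j *+ j) * g (k - j)%N +
  \sum_(j < k.+1) f j * (g (k - j)%N *+ (k - j)).
Proof.
rewrite series_mulEl -sumrMnl -big_split /=; apply: eq_bigr => j _.
have jk : (j <= k)%N by rewrite -ltnS.
by rewrite mulrnAl mulrnAr -mulrnDr subnKC.
Qed.

Fact dserM f g : dser (f * g) = dser f * g + f * dser g.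
Proof.
apply: seriesP => k; rewrite [LHS]/= -/((f * g) k.+1) eulerM series_addE.
congr (_ + _).
  by rewrite big_ord_recl mulr0n mul0r add0r; apply: eq_bigr => j _.
rewrite big_ord_recr /= subnn mulr0n mulr0 addr0; apply: eq_bigr => j _.
by rewrite subSn // -ltnS.
Qed.

Let oppr_mulr0n (x : A) : - (x *+ 0) = 0. Proof. exact: oppr0. Qed.

Fact dinvM f g : dinv (f * g) = dinv f * g + f * dinv g.
Proof.
apply: seriesP => -[|k].
  by rewrite series_addE !series_mulEl !big_ord1 /= !oppr_mulr0n mul0r mulr0 addr0.
rewrite [LHS]/= -/((f * g) k) eulerM series_addE opprD; congr (_ + _).
  rewrite series_mulEl [in RHS]big_ord_recl /= oppr_mulr0n mul0r add0r -sumrN.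
  by apply: eq_bigr => j _; rewrite mulNr.
rewrite series_mulEl [in RHS]big_ord_recr /= subnn /= oppr_mulr0n mulr0 addr0 -sumrN.
by apply: eq_bigr => j _; rewrite mulrN subSn // -ltnS.
Qed.

Definition series_ddu := Derivation dserD dserM.
Definition series_inv_ddu := Derivation dinvD dinvM.
End SeriesDerivations.

(* dop d is the ring of differential operators sum_i a_i D^i, a_i in S,
   with D a = a D + d(a); the operator is stored as the polynomial with
   coefficients a_i, and only the addition is that of polynomials *)
Record dop (S : nzRingType) (d : derivation S) := Dop { dop_poly : {poly S} }.

HB.instance Definition _ (S : nzRingType) (d : derivation S) :=
  [isNew for @dop_poly S d].
HB.instance Definition _ (S : nzRingType) (d : derivation S) :=
  [Choice of dop d by <:].

Section DopRing.
Variables (S : nzRingType) (d : derivation S).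
Implicit Types (a b : S) (p q r : {poly S}).

Fact der0 : d 0 = 0.
Proof. by apply: (addIr (d 0)); rewrite -derD !add0r. Qed.

Fact der1 : d 1 = 0.
Proof.
by apply: (addIr (d 1)); rewrite add0r -{3}[1]mulr1 derM mulr1 mul1r.
Qed.

(* D * sum_i q_i D^i *)
Definition dleft q : {poly S} := q * 'X + \poly_(i < size q) d q`_i.

Definition dmul p q : {poly S} := \sum_(i < size p) p`_i *: iter i dleft q.

Let coef_dleft q i : (dleft q)`_i = (if i == 0%N then 0 else q`_i.-1) + d q`_i.
Proof.
rewrite coefD coefMX coef_poly; congr (_ + _); case: ltnP => // qi.
by rewrite nth_default // der0.
Qed.

Let dleftD : {morph dleft : p q / p + q}.
Proof.
move=> p q; apply/polyP => i; rewrite coefD !coef_dleft !coefD derD.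
by case: ifP => _; rewrite ?add0r // addrACA.
Qed.

Let dleft0 : dleft 0 = 0.
Proof. by apply/polyP=> i; rewrite coef_dleft !coef0 der0 if_same addr0. Qed.

Let dleftZ a p : dleft (a *: p) = a *: dleft p + d a *: p.
Proof.
apply/polyP => i; rewrite [in RHS]coefD [in RHS]coefZ [in RHS]coefZ !coef_dleft !coefZ derM mulrDr.
by case: ifP => _; rewrite ?mulr0 ?add0r -?addrA [d a * _ + _]addrC.
Qed.

Let iterD i : {morph iter i dleft : p q / p + q}.
Proof. by move=> p q; elim: i => //= i ->. Qed.

Let iter0 i : iter i dleft 0 = 0. Proof. by elim: i => //= i ->. Qed.

Let dmulE n p q : (size p <= n)%N ->
  dmul p q = \sum_(i < n) p`_i *: iter i dleft q.
Proof.
move=> pn; rewrite /dmul (big_ord_widen n (fun i => p`_i *: iter i dleft q)) //.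
rewrite big_mkcond /=; apply: eq_bigr => i _; case: ltnP => // pi.
by rewrite nth_default // scale0r.
Qed.

Let dmulDr p : {morph dmul p : q r / q + r}.
Proof.
by move=> q r; rewrite /dmul -big_split; apply: eq_bigr => i _; rewrite iterD scalerDr.
Qed.

Let dmulDl p q r : dmul (p + q) r = dmul p r + dmul q r.
Proof.
pose n := maxn (size p) (size q).
rewrite (dmulE (n := n)) ?size_polyD // (@dmulE n p) ?leq_maxl //.
rewrite (@dmulE n q) ?leq_maxr // -big_split /=.
by apply: eq_bigr => i _; rewrite coefD scalerDl.
Qed.

Let dmul0 p : dmul p 0 = 0.
Proof. by rewrite /dmul big1 // => i _; rewrite iter0 scaler0. Qed.

Let dmul0l p : dmul 0 p = 0.
Proof. by rewrite /dmul size_poly0 big_ord0. Qed.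

Let dmulZ a p q : dmul (a *: p) q = a *: dmul p q.
Proof.
rewrite (@dmulE (size p)) ?size_scale_leq // scaler_sumr.
by apply: eq_bigr => i _; rewrite coefZ scalerA.
Qed.

Let dleft_dmul q r : dleft (dmul q r) = dmul (dleft q) r.
Proof.
pose n := size q.
have sz : (size (dleft q) <= n.+1)%N.
  apply/leq_sizeP => j nj; rewrite coef_dleft.
  rewrite [q`_j]nth_default ?der0 ?addr0; last exact: leq_trans (leqnSn _) nj.
  by case: j nj => //= j nj; rewrite nth_default.
rewrite (dmulE _ sz) /dmul (big_morph dleft dleftD dleft0) -/n.
under eq_bigr do rewrite dleftZ.
rewrite big_split /=.
under [RHS]eq_bigr do rewrite coef_dleft scalerDl.
rewrite big_split /=; congr (_ + _).
  by rewrite big_ord_recl /= scale0r add0r.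
by rewrite big_ord_recr /= [q`_n]nth_default // der0 scale0r addr0.
Qed.

Let dmulA : associative dmul.
Proof.
move=> p q r; rewrite {2}/dmul.
rewrite (big_morph (dmul^~ r) (fun x y => dmulDl x y r) (dmul0l r)) /=.
rewrite {1}/dmul; apply: eq_bigr => i _; rewrite dmulZ; congr (_ *: _).
by elim: (val i) => //= j ->; rewrite dleft_dmul.
Qed.

Let dmul1 : left_id 1 dmul.
Proof. by move=> p; rewrite /dmul size_poly1 big_ord1 coefC scale1r. Qed.

Let iter1 i : iter i dleft 1 = 'X^i.
Proof.
elim: i => //= i ->; apply/polyP => j; rewrite coef_dleft !coefXn.
rewrite (_ : d _ = 0) ?addr0; first by case: j.
by case: eqP; rewrite /= ?mulr1n ?mulr0n (der1, der0).
Qed.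

Let dmulr1 : right_id 1 dmul.
Proof.
move=> p; rewrite /dmul -[RHS]coefK poly_def.
by apply: eq_bigr => i _; rewrite iter1.
Qed.

Definition dop_add (P Q : dop d) := @Dop S d (dop_poly P + dop_poly Q).
Definition dop_opp (P : dop d) := @Dop S d (- dop_poly P).
Definition dop_mul (P Q : dop d) := @Dop S d (dmul (dop_poly P) (dop_poly Q)).

Lemma dopP (P Q : dop d) : dop_poly P = dop_poly Q -> P = Q.
Proof. by case: P Q => [P] [Q] /= ->. Qed.

Fact dop_addA : associative dop_add.
Proof. by move=> P Q T; apply: dopP; apply: addrA. Qed.
Fact dop_addC : commutative dop_add.
Proof. by move=> P Q; apply: dopP; apply: addrC. Qed.
Fact dop_add0 : left_id (@Dop S d 0) dop_add.
Proof. by move=> P; apply: dopP; apply: add0r. Qed.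
Fact dop_addN : left_inverse (@Dop S d 0) dop_opp dop_add.
Proof. by move=> P; apply: dopP; apply: addNr. Qed.

HB.instance Definition _ := GRing.isZmodule.Build (dop d)
  dop_addA dop_addC dop_add0 dop_addN.

Fact dop_mulA : associative dop_mul.
Proof. by move=> P Q T; apply: dopP; apply: dmulA. Qed.
Fact dop_mul1 : left_id (@Dop S d 1) dop_mul.
Proof. by move=> P; apply: dopP; apply: dmul1. Qed.
Fact dop_mulr1 : right_id (@Dop S d 1) dop_mul.
Proof. by move=> P; apply: dopP; apply: dmulr1. Qed.
Fact dop_mulDl : left_distributive dop_mul +%R.
Proof. by move=> P Q T; apply: dopP; apply: dmulDl. Qed.
Fact dop_mulDr : right_distributive dop_mul +%R.
Proof. by move=> P Q T; apply: dopP; apply: dmulDr. Qed.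
Fact dop_1neq0 : @Dop S d 1 != 0.
Proof. by apply/eqP => /(congr1 (@dop_poly S d))/eqP; rewrite oner_eq0. Qed.

HB.instance Definition _ := GRing.Zmodule_isNzRing.Build (dop d)
  dop_mulA dop_mul1 dop_mulr1 dop_mulDl dop_mulDr dop_1neq0.

Definition dop_fun (a : S) : dop d := Dop d a%:P.
Definition dop_D : dop d := Dop d 'X.
Definition dop_coef (P : dop d) (i : nat) : S := (dop_poly P)`_i.

Lemma dop_DM a : dop_D * dop_fun a = dop_fun a * dop_D + dop_fun (d a).
Proof.
apply: dopP; rewrite /= (@dmulE 2) ?size_polyX // !big_ord_recl big_ord0 /=.
rewrite !coefX /= scale0r add0r addr0 scale1r (@dmulE 1) ?size_polyC_leq1 //.
rewrite big_ord1 coefC /=; apply/polyP => i.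
by rewrite coef_dleft coefD coefZ coefX !coefC; case: i => [|[|i]] /=;
  rewrite ?der0 ?mulr1 ?mulr0.
Qed.

End DopRing.

Record lend (C : comNzRingType) (V : lmodType C) :=
  Lend { lend_fun :> V -> V; lendP : linear lend_fun }.

HB.instance Definition _ (C : comNzRingType) (V : lmodType C) (f : lend V) :=
  GRing.isLinear.Build C V V *:%R (lend_fun f) (lendP f).
HB.instance Definition _ (C : comNzRingType) (V : lmodType C) := gen_eqMixin (lend V).
HB.instance Definition _ (C : comNzRingType) (V : lmodType C) := gen_choiceMixin (lend V).

Section LendAlgebra.
Variables (C : comNzRingType) (V : lmodType C).
Implicit Types f g h : lend V.

Lemma lendE f g : (forall v, f v = g v) -> f = g.
Proof.
case: f => f fP; case: g => g gP /= fg.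
have {}fg : f = g by apply/funext.
by case: g / fg gP => gP; congr Lend; apply: Prop_irrelevance.
Qed.

Fact lend_add_linear f g : linear (fun v => f v + g v).
Proof. by move=> a u v; rewrite !linearP scalerDr addrACA. Qed.
Fact lend_opp_linear f : linear (fun v => - f v).
Proof. by move=> a u v; rewrite linearP opprD scalerN. Qed.
Fact lend_zero_linear : linear (fun _ : V => 0 : V).
Proof. by move=> a u v; rewrite scaler0 addr0. Qed.
Fact lend_one_linear : linear (fun v : V => v).
Proof. by []. Qed.
Fact lend_mul_linear f g : linear (fun v => f (g v)).
Proof. by move=> a u v; rewrite !linearP. Qed.
Fact lend_scale_linear c f : linear (fun v => c *: f v).
Proof. by move=> a u v; rewrite linearP scalerDr !scalerA mulrC. Qed.

Definition lend_add f g := Lend (lend_add_linear f g).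
Definition lend_opp f := Lend (lend_opp_linear f).
Definition lend_zero := Lend lend_zero_linear.
Definition lend_one := Lend lend_one_linear.
Definition lend_mul f g := Lend (lend_mul_linear f g).
Definition lend_scale c f := Lend (lend_scale_linear c f).

Fact lend_addA : associative lend_add.
Proof. by move=> f g h; apply: lendE => v; apply: addrA. Qed.
Fact lend_addC : commutative lend_add.
Proof. by move=> f g; apply: lendE => v; apply: addrC. Qed.
Fact lend_add0 : left_id lend_zero lend_add.
Proof. by move=> f; apply: lendE => v; apply: add0r. Qed.
Fact lend_addN : left_inverse lend_zero lend_opp lend_add.
Proof. by move=> f; apply: lendE => v; apply: addNr. Qed.

HB.instance Definition _ := GRing.isZmodule.Build (lend V)
  lend_addA lend_addC lend_add0 lend_addN.

Fact lend_mulA : associative lend_mul. Proof. by move=> f g h; apply: lendE. Qed.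
Fact lend_mul1 : left_id lend_one lend_mul. Proof. by move=> f; apply: lendE. Qed.
Fact lend_mulr1 : right_id lend_one lend_mul. Proof. by move=> f; apply: lendE. Qed.
Fact lend_mulDl : left_distributive lend_mul +%R.
Proof. by move=> f g h; apply: lendE. Qed.
Fact lend_mulDr : right_distributive lend_mul +%R.
Proof. by move=> f g h; apply: lendE => v /=; rewrite linearD. Qed.

HB.instance Definition _ := GRing.Zmodule_isPzRing.Build (lend V)
  lend_mulA lend_mul1 lend_mulr1 lend_mulDl lend_mulDr.

Fact lend_scaleA a b f : lend_scale a (lend_scale b f) = lend_scale (a * b) f.
Proof. by apply: lendE => v /=; rewrite scalerA. Qed.
Fact lend_scale1 : left_id 1 lend_scale.
Proof. by move=> f; apply: lendE => v; apply: scale1r. Qed.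
Fact lend_scaleDr : right_distributive lend_scale +%R.
Proof. by move=> a f g; apply: lendE => v; apply: scalerDr. Qed.
Fact lend_scaleDl f : {morph lend_scale^~ f : a b / a + b}.
Proof. by move=> a b; apply: lendE => v; apply: scalerDl. Qed.

HB.instance Definition _ := GRing.Zmodule_isLmodule.Build C (lend V)
  lend_scaleA lend_scale1 lend_scaleDr lend_scaleDl.

Lemma lend_scaleAl a f g : a *: (f * g) = (a *: f) * g.
Proof. exact: lendE. Qed.
Lemma lend_scaleAr a f g : a *: (f * g) = f * (a *: g).
Proof. by apply: lendE => v /=; rewrite linearZ. Qed.

End LendAlgebra.

(* gl_N (x) C[t] is the set of N x N matrices over C[t], a C-module through
   c%:P *: x, and its pointwise bracket is the matrix commutator *)
Notation glt C N := 'M[{poly C}]_N.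

Definition glt_bracket (C : comNzRingType) N (x y : glt C N) : glt C N :=
  x *m y - y *m x.

(* g (x) t^r *)
Definition glt_tensor (C : comNzRingType) N (g : 'M[C]_N) (r : nat) : glt C N :=
  map_mx (fun c => c *: 'X^r) g.

Section Enveloping.
Variables (C : comNzRingType) (N : nat).

(* U is the quotient of the set of formal algebraic expressions in the symbols
   uGen x, x in gl_N[t], by the smallest congruence for which the quotient is an
   associative unital C-algebra and uGen is a morphism of Lie algebras *)
Inductive uterm : Type :=
| uGen of glt C N
| uCst of C
| uAdd of uterm & uterm
| uMul of uterm & uterm.

Inductive ueq : uterm -> uterm -> Prop :=
| ueq_refl a : ueq a a
| ueq_sym a b : ueq a b -> ueq b a
| ueq_trans a b c : ueq a b -> ueq b c -> ueq a c
| ueq_add a a' b b' : ueq a a' -> ueq b b' -> ueq (uAdd a b) (uAdd a' b')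
| ueq_mul a a' b b' : ueq a a' -> ueq b b' -> ueq (uMul a b) (uMul a' b')
| ueq_addA a b c : ueq (uAdd a (uAdd b c)) (uAdd (uAdd a b) c)
| ueq_addC a b : ueq (uAdd a b) (uAdd b a)
| ueq_add0 a : ueq (uAdd (uCst 0) a) a
| ueq_addN a : ueq (uAdd (uMul (uCst (-1)) a) a) (uCst 0)
| ueq_mulA a b c : ueq (uMul a (uMul b c)) (uMul (uMul a b) c)
| ueq_mul1 a : ueq (uMul (uCst 1) a) a
| ueq_mulDl a b c : ueq (uMul (uAdd a b) c) (uAdd (uMul a c) (uMul b c))
| ueq_mulDr a b c : ueq (uMul a (uAdd b c)) (uAdd (uMul a b) (uMul a c))
| ueq_cstD c c' : ueq (uCst (c + c')) (uAdd (uCst c) (uCst c'))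
| ueq_cstM c c' : ueq (uCst (c * c')) (uMul (uCst c) (uCst c'))
| ueq_cstC c a : ueq (uMul (uCst c) a) (uMul a (uCst c))
| ueq_genD x y : ueq (uGen (x + y)) (uAdd (uGen x) (uGen y))
| ueq_genZ c x : ueq (uGen (c%:P *: x)) (uMul (uCst c) (uGen x))
| ueq_gen_bracket x y :
    ueq (uAdd (uGen (glt_bracket x y)) (uMul (uGen y) (uGen x)))
        (uMul (uGen x) (uGen y)).

HB.instance Definition _ := gen_eqMixin uterm.
HB.instance Definition _ := gen_choiceMixin uterm.

Definition ueqb (a b : uterm) : bool := `[< ueq a b >].

Fact ueqb_refl : reflexive ueqb.
Proof. by move=> a; apply/asboolP; apply: ueq_refl. Qed.
Fact ueqb_sym a b : ueqb a b = ueqb b a.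
Proof. by apply/asboolP/asboolP => /ueq_sym. Qed.
Fact ueqb_trans : transitive ueqb.
Proof.
by move=> b a c /asboolP ab /asboolP bc; apply/asboolP; apply: ueq_trans bc.
Qed.

Canonical ueq_equiv := EquivRel ueqb ueqb_refl ueqb_sym ueqb_trans.

Definition Uglt := {eq_quot ueq_equiv}.

HB.instance Definition _ := Choice.on Uglt.

Definition upi (a : uterm) : Uglt := \pi_({eq_quot ueq_equiv}) a.
Definition urep (x : Uglt) : uterm := repr x.

Lemma urepK x : upi (urep x) = x. Proof. exact: reprK. Qed.
Lemma upiP a b : upi a = upi b <-> ueq a b.
Proof. by split=> [/eqmodP/asboolP | ab]; last by apply/eqmodP/asboolP. Qed.
Lemma urep_pi a : ueq (urep (upi a)) a.
Proof. by apply/upiP; rewrite urepK. Qed.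

Let uind (P : Uglt -> Prop) : (forall a, P (upi a)) -> forall x, P x.
Proof. by move=> Pa x; rewrite -[x]urepK. Qed.

Definition U_add (x y : Uglt) := upi (uAdd (urep x) (urep y)).
Definition U_mul (x y : Uglt) := upi (uMul (urep x) (urep y)).
Definition U_cst c : Uglt := upi (uCst c).
Definition U_gen (x : glt C N) : Uglt := upi (uGen x).
Definition U_opp x := U_mul (U_cst (-1)) x.
Definition U_scale c x := U_mul (U_cst c) x.

Lemma U_addE a b : U_add (upi a) (upi b) = upi (uAdd a b).
Proof. by apply/upiP; apply: ueq_add; apply: urep_pi. Qed.
Lemma U_mulE a b : U_mul (upi a) (upi b) = upi (uMul a b).
Proof. by apply/upiP; apply: ueq_mul; apply: urep_pi. Qed.

Fact U_addA : associative U_add.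
Proof.
elim/uind=> a; elim/uind=> b; elim/uind=> c.
by rewrite !U_addE; apply/upiP; constructor.
Qed.
Fact U_addC : commutative U_add.
Proof.
by elim/uind=> a; elim/uind=> b; rewrite !U_addE; apply/upiP; apply: ueq_addC.
Qed.
Fact U_add0 : left_id (U_cst 0) U_add.
Proof. by elim/uind=> a; rewrite U_addE; apply/upiP; constructor. Qed.
Fact U_addN : left_inverse (U_cst 0) U_opp U_add.
Proof.
by elim/uind=> a; rewrite /U_opp U_mulE U_addE; apply/upiP; constructor.
Qed.

HB.instance Definition _ := GRing.isZmodule.Build Uglt
  U_addA U_addC U_add0 U_addN.

Fact U_mulA : associative U_mul.
Proof.
elim/uind=> a; elim/uind=> b; elim/uind=> c.
by rewrite !U_mulE; apply/upiP; constructor.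
Qed.
Fact U_mul1 : left_id (U_cst 1) U_mul.
Proof. by elim/uind=> a; rewrite U_mulE; apply/upiP; constructor. Qed.
Lemma U_cst_comm c x : U_mul (U_cst c) x = U_mul x (U_cst c).
Proof. by elim/uind: x => a; rewrite !U_mulE; apply/upiP; constructor. Qed.
Fact U_mulr1 : right_id (U_cst 1) U_mul.
Proof. by move=> x; rewrite -U_cst_comm U_mul1. Qed.
Fact U_mulDl : left_distributive U_mul U_add.
Proof.
elim/uind=> a; elim/uind=> b; elim/uind=> c.
by rewrite !(U_addE, U_mulE); apply/upiP; constructor.
Qed.
Fact U_mulDr : right_distributive U_mul U_add.
Proof.
elim/uind=> a; elim/uind=> b; elim/uind=> c.
by rewrite !(U_addE, U_mulE); apply/upiP; constructor.
Qed.

Lemma U_cstD c c' : U_cst (c + c') = U_add (U_cst c) (U_cst c').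
Proof. by rewrite U_addE; apply/upiP; constructor. Qed.
Lemma U_cstM c c' : U_cst (c * c') = U_mul (U_cst c) (U_cst c').
Proof. by rewrite U_mulE; apply/upiP; constructor. Qed.

Section Lift.
Variables (V : lmodType C) (phi : glt C N -> lend V).

Definition lie_morphism :=
  [/\ forall x y, phi (x + y) = phi x + phi y,
      forall c x, phi (c%:P *: x) = c *: phi x &
      forall x y, phi (glt_bracket x y) = phi x * phi y - phi y * phi x].

Fixpoint ueval (a : uterm) : lend V :=
  match a with
  | uGen x => phi x
  | uCst c => c *: (1 : lend V)
  | uAdd a b => ueval a + ueval b
  | uMul a b => ueval a * ueval b
  end.

Lemma ueval_eq a b : lie_morphism -> ueq a b -> ueval a = ueval b.
Proof.
case=> phiD phiZ phiB; elim=> {a b} //=.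
- by move=> a b c _ -> _ ->.
- by move=> a a' b b' _ -> _ ->.
- by move=> a a' b b' _ -> _ ->.
- by move=> a b c; rewrite addrA.
- by move=> a b; rewrite addrC.
- by move=> a; rewrite scale0r add0r.
- by move=> a; rewrite -lend_scaleAl mul1r scaleN1r addNr scale0r.
- by move=> a b c; rewrite mulrA.
- by move=> a; rewrite scale1r mul1r.
- by move=> a b c; rewrite mulrDl.
- by move=> a b c; rewrite mulrDr.
- by move=> c c'; rewrite scalerDl.
- by move=> c c'; rewrite -lend_scaleAl mul1r scalerA.
- by move=> c a; rewrite -lend_scaleAl -lend_scaleAr mul1r mulr1.
- by move=> c x; rewrite phiZ -lend_scaleAl mul1r.
- by move=> x y; rewrite phiB subrK.
Qed.

Definition U_lift (x : Uglt) : lend V := ueval (urep x).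

Hypothesis phiP : lie_morphism.

Lemma U_lift_pi a : U_lift (upi a) = ueval a.
Proof. by apply: ueval_eq => //; apply: urep_pi. Qed.

Lemma U_lift_gen x : U_lift (U_gen x) = phi x. Proof. exact: U_lift_pi. Qed.
Lemma U_lift_cst c : U_lift (U_cst c) = c *: (1 : lend V). Proof. exact: U_lift_pi. Qed.
Lemma U_liftD x y : U_lift (U_add x y) = U_lift x + U_lift y.
Proof.
by elim/uind: x => a; elim/uind: y => b; rewrite U_addE !U_lift_pi.
Qed.
Lemma U_liftM x y : U_lift (U_mul x y) = U_lift x * U_lift y.
Proof.
by elim/uind: x => a; elim/uind: y => b; rewrite U_mulE !U_lift_pi.
Qed.
End Lift.

Fact U_1neq0 : U_cst 1 != 0.
Proof.
pose phi (x : glt C N) : lend C^o := 0.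
have phiP : lie_morphism phi.
  by split=> *; rewrite /phi ?addr0 ?scaler0 ?mul0r ?subr0.
apply/eqP => /(congr1 (U_lift phi)).
rewrite (U_lift_cst phiP) [RHS](U_lift_cst phiP) scale1r scale0r.
move=> /(congr1 (fun f : lend C^o => f 1)) /= /eqP.
by rewrite oner_eq0.
Qed.

HB.instance Definition _ := GRing.Zmodule_isNzRing.Build Uglt
  U_mulA U_mul1 U_mulr1 U_mulDl U_mulDr U_1neq0.

Fact U_scaleA a b x : U_scale a (U_scale b x) = U_scale (a * b) x.
Proof. by rewrite /U_scale U_cstM U_mulA. Qed.
Fact U_scale1 : left_id 1 U_scale. Proof. exact: U_mul1. Qed.
Fact U_scaleDr : right_distributive U_scale +%R.
Proof. by move=> c x y; apply: U_mulDr. Qed.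
Fact U_scaleDl x : {morph U_scale^~ x : a b / a + b}.
Proof. by move=> a b; rewrite /U_scale U_cstD; apply: U_mulDl. Qed.

HB.instance Definition _ := GRing.Zmodule_isLmodule.Build C Uglt
  U_scaleA U_scale1 U_scaleDr U_scaleDl.

Fact U_scaleAl (c : C) (x y : Uglt) : c *: (x * y) = (c *: x) * y.
Proof. exact: U_mulA. Qed.
HB.instance Definition _ := GRing.Lmodule_isLalgebra.Build C Uglt U_scaleAl.

Fact U_scaleAr (c : C) (x y : Uglt) : c *: (x * y) = x * (c *: y).
Proof.
rewrite [LHS]U_mulA [RHS]U_mulA; congr (U_mul _ y); exact: U_cst_comm.
Qed.
HB.instance Definition _ := GRing.Lalgebra_isAlgebra.Build C Uglt U_scaleAr.

End Enveloping.

Inductive generated_subalg (C : comNzRingType) (A : algType C) (S : A -> Prop) :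
    A -> Prop :=
| gsub_gen x : S x -> generated_subalg S x
| gsub_one : generated_subalg S 1
| gsub_scale c x : generated_subalg S x -> generated_subalg S (c *: x)
| gsub_add x y :
    generated_subalg S x -> generated_subalg S y -> generated_subalg S (x + y)
| gsub_mul x y :
    generated_subalg S x -> generated_subalg S y -> generated_subalg S (x * y).

Section Bethe.
Variables (C : comNzRingType) (N : nat) (K : 'I_N -> C).

(* g(u) = sum_(r >= 0) (g (x) t^r) u^(-r-1), a power series in u^-1 *)
Definition U_current (g : 'M[C]_N) : series (Uglt C N) :=
  Series (fun k => if k is r.+1 then U_gen (glt_tensor g r) else 0).

Definition Bethe_dop := dop (series_inv_ddu (Uglt C N)).

(* For noncommuting entries, \det is the row determinant: the factors of its
   products are taken in the order of the rows *)
Definition DB : Bethe_dop :=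
  \det (\matrix_(i, j)
    ((if i == j then dop_D _ - dop_fun _ (series_const (K i)%:A) else 0)
     - dop_fun _ (U_current (delta_mx j i)))).

(* i : 'I_N starts at 0: this is B_(i+1),j, a coefficient of D^(N-i-1) *)
Definition Bethe_gen (i : 'I_N) (j : nat) : Uglt C N := dop_coef DB (N - i.+1) j.

Definition Bethe_alg : Uglt C N -> Prop :=
  generated_subalg (fun x => exists i j, x = Bethe_gen i j).
End Bethe.

Section TensorModule.
Variables (C : comNzRingType) (N n : nat).

(* An element is given by its coordinates in C[z_1, ..., z_n] with respect to
   the basis e_a = e_(a 0) (x) ... (x) e_(a (n-1)), a : 'I_n -> 'I_N *)
Definition tensmod := {ffun {ffun 'I_n -> 'I_N} -> {mpoly C[n]}}.

HB.instance Definition _ := GRing.Lmodule.on tensmod.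

Implicit Types w : tensmod.

Definition subst_at (a : {ffun 'I_n -> 'I_N}) (s : 'I_n) (j : 'I_N) :
    {ffun 'I_n -> 'I_N} :=
  [ffun k => if k == s then j else a k].

(* The matrix G acting on the s-th tensor factor *)
Definition factor_act (s : 'I_n) (G : 'M[{mpoly C[n]}]_N) w : tensmod :=
  [ffun a : {ffun 'I_n -> 'I_N} => \sum_j G (a s) j * w (subst_at a s j)].

(* p(t) |-> p(z_s) *)
Definition eval_z (s : 'I_n) : {poly C} -> {mpoly C[n]} :=
  horner_eval 'X_s \o map_poly (@mpolyC n C).

HB.instance Definition _ s := GRing.RMorphism.on (eval_z s).

Definition glt_act (x : glt C N) w : tensmod :=
  \sum_s factor_act s (map_mx (eval_z s) x) w.

Lemma glt_act_tensor g r w :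
  glt_act (glt_tensor g r) w =
  \sum_s [ffun a : {ffun 'I_n -> 'I_N} => 'X_s ^+ r * factor_act s (map_mx (@mpolyC n C) g) w a].
Proof.
apply: eq_bigr => s _; apply/ffunP => a; rewrite !ffunE mulr_sumr.
apply: eq_bigr => j _; rewrite !mxE mulrA; congr (_ * _).
rewrite /eval_z /= map_polyZ map_polyXn /horner_eval hornerZ hornerXn.
by rewrite mulrC.
Qed.

Fact factor_act_linear s G : linear (factor_act s G).
Proof.
move=> c w w'; apply/ffunP => a; rewrite !ffunE scaler_sumr -big_split /=.
by apply: eq_bigr => j _; rewrite !ffunE mulrDr scalerAr.
Qed.

Fact glt_act_linear x : linear (glt_act x).
Proof.
move=> c w w'; rewrite /glt_act scaler_sumr -big_split /=.
by apply: eq_bigr => s _; rewrite factor_act_linear.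
Qed.

Definition glt_end (x : glt C N) : lend tensmod := Lend (glt_act_linear x).

Lemma factor_actM s G H w :
  factor_act s G (factor_act s H w) = factor_act s (G *m H) w.
Proof.
apply/ffunP => a; rewrite !ffunE.
under eq_bigr do rewrite ffunE mulr_sumr.
rewrite exchange_big /=; apply: eq_bigr => k _.
rewrite mxE mulr_suml; apply: eq_bigr => j _; rewrite mulrA ffunE eqxx.
congr (_ * w _); apply/ffunP => l; rewrite !ffunE.
by case: eqP.
Qed.

Lemma factor_actC s s' G H w : s != s' ->
  factor_act s G (factor_act s' H w) = factor_act s' H (factor_act s G w).
Proof.
move=> ss'; apply/ffunP => a; rewrite !ffunE.
under eq_bigr do rewrite ffunE mulr_sumr.
under [RHS]eq_bigr do rewrite ffunE mulr_sumr.
rewrite exchange_big /=; apply: eq_bigr => k _; apply: eq_bigr => j _.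
have s's : (s' == s) = false by rewrite eq_sym (negPf ss').
rewrite !ffunE (negPf ss') s's mulrCA.
congr (_ * (_ * w _)); apply/ffunP => l; rewrite !ffunE.
by case: (eqVneq l s') => // ->; rewrite eq_sym (negPf ss').
Qed.

Lemma factor_actBl s G H w :
  factor_act s (G - H) w = factor_act s G w - factor_act s H w.
Proof.
apply/ffunP => a; rewrite !ffunE -sumrB; apply: eq_bigr => j _.
by rewrite !mxE mulrBl.
Qed.

Fact glt_end_lie : lie_morphism glt_end.
Proof.
split=> [x y | c x | x y]; apply: lendE => w /=.
- rewrite /glt_act -big_split; apply: eq_bigr => s _; apply/ffunP => a.
  rewrite !ffunE -big_split; apply: eq_bigr => j _.
  by rewrite !mxE rmorphD mulrDl.
- rewrite /glt_act scaler_sumr; apply: eq_bigr => s _; apply/ffunP => a.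
  rewrite !ffunE scaler_sumr; apply: eq_bigr => j _.
  rewrite !mxE rmorphM /= {1}/eval_z /= map_polyC /horner_eval hornerC.
  by rewrite -mulrA mul_mpolyC.
have expand (x1 x2 : glt C N) : glt_act x1 (glt_act x2 w) =
    \sum_s \sum_s' factor_act s (map_mx (eval_z s) x1)
                     (factor_act s' (map_mx (eval_z s') x2) w).
  apply: eq_bigr => s _; rewrite -[factor_act s _]/(lend_fun (Lend (factor_act_linear s _))).
  by rewrite raddf_sum.
rewrite !expand [X in _ - X]exchange_big -sumrB; apply: eq_bigr => s _.
rewrite (bigD1 s) //= [X in _ - X](bigD1 s) //= opprD addrACA.
rewrite -[X in _ + X]sumrB [X in _ + X]big1 ?addr0; last first.
  by move=> s' ss'; rewrite factor_actC 1?eq_sym // subrr.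
by rewrite !factor_actM -!map_mxM -factor_actBl -map_mxB.
Qed.

Definition U_act : Uglt C N -> lend tensmod := U_lift glt_end.

Fact U_act_linear : linear U_act.
Proof.
move=> c x y; rewrite [LHS](U_liftD glt_end_lie) (U_liftM glt_end_lie).
by rewrite (U_lift_cst glt_end_lie) -lend_scaleAl mul1r.
Qed.
Fact U_act_monoid : monoid_morphism U_act.
Proof.
split=> [|x y]; last exact: (U_liftM glt_end_lie).
by rewrite [LHS](U_lift_cst glt_end_lie) scale1r.
Qed.

HB.instance Definition _ := GRing.isLinear.Build C (Uglt C N) (lend tensmod) *:%R
  U_act U_act_linear.
HB.instance Definition _ := GRing.isMonoidMorphism.Build (Uglt C N) (lend tensmod)
  U_act U_act_monoid.

(* s sends p(z) e_a to p(z_(s 0), ..., z_(s (n-1))) e_(a o s^-1) *)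
Definition perm_act (s : 'S_n) w : tensmod :=
  [ffun a : {ffun 'I_n -> 'I_N} => msym s (w [ffun k => a (s k)])].

Variable lam : 'I_N -> nat.

Definition inv_weight : {pred tensmod} :=
  fun w => [forall s, perm_act s w == w] &&
    [forall i, glt_act (glt_tensor (delta_mx i i) 0) w == (lam i)%:R *: w].

Fact inv_weight_submod : submod_closed inv_weight.
Proof.
split=> [|c w w' /andP[/forallP sw /forallP ww] /andP[/forallP sw' /forallP ww']].
  apply/andP; split; apply/forallP => s; apply/eqP.
    by apply/ffunP => a; rewrite !ffunE rmorph0.
  by rewrite -[glt_act _]/(lend_fun (glt_end _)) linear0 scaler0.
apply/andP; split; apply/forallP => s; apply/eqP; last first.
  rewrite glt_act_linear (eqP (ww s)) (eqP (ww' s)) scalerDr !scalerA.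
  by rewrite mulrC.
rewrite -[in RHS](eqP (sw s)) -[in RHS](eqP (sw' s)).
by apply/ffunP => a; rewrite !ffunE linearP.
Qed.

HB.instance Definition _ := GRing.isSubmodClosed.Build C tensmod inv_weight
  inv_weight_submod.

Record Mlam := MkMlam { Mval : tensmod; _ : Mval \in inv_weight }.

HB.instance Definition _ := [isSub for Mval].
HB.instance Definition _ := [Choice of Mlam by <:].
HB.instance Definition _ := [SubChoice_isSubLmodule of Mlam by <:].

(* The degree for deg z_i = 1, deg e_a = 0, meant for w <> 0 *)
Definition tens_deg w : nat := \max_a \max_(m <- msupp (w a)) mdeg m.

Definition restricts_to (x : Uglt C N) (T : lend Mlam) : Prop :=
  forall m : Mlam, Mval (T m) = U_act x (Mval m).

Definition Bethe_image (K : 'I_N -> C) (T : lend Mlam) : Prop :=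
  exists2 x, Bethe_alg K x & restricts_to x T.
End TensorModule.

Section OAlgebra.
Variables (C : numFieldType) (N : nat) (K : 'I_N -> C) (lam : 'I_N -> nat).

(* The indices (i, j) of the variables f_(i+1),(j+1) *)
Definition Oidx := {i : 'I_N & 'I_(lam i)}.

Definition Olam := {mpoly C[#|{: Oidx}|]}.

Definition Ovar (i : 'I_N) (j : 'I_(lam i)) : Olam :=
  'X_(enum_rank (Tagged (fun i => 'I_(lam i)) j : Oidx)).

(* The degree for deg f_ij = j, meant for p <> 0 *)
Definition Odeg (p : Olam) : nat :=
  \max_(m <- msupp p) \sum_k (m k * (tagged (enum_val k)).+1)%N.

Definition exp_series (c : C) : series Olam :=
  Series (fun k => (c ^+ k / k`!%:R)%:MP).

Definition quasi_exp (i : 'I_N) : series Olam :=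
  exp_series (K i) *
  poly_series ('X^(lam i) + \sum_(j < lam i) (Ovar j) *: 'X^(lam i - j.+1)).

Definition quasi_exp_der (i : 'I_N) (k : nat) : series Olam :=
  iter k (series_ddu Olam) (quasi_exp i).

Definition Wr : series Olam := \det (\matrix_(i, j < N) quasi_exp_der i j).

Definition bordered_rdet : dop (series_ddu Olam) :=
  \det (\matrix_(i < N.+1, j < N.+1)
    if unlift ord_max i is Some i' then dop_fun _ (quasi_exp_der i' j)
    else dop_D _ ^+ j).

(* The ratio g / h of power series in u is a rational function P / W of u, whose
   expansion at u = oo is sum_j F_j u^-j; the last equation is P = F W divided
   by u^m, in the ring of power series in u^-1 *)
Definition expands_at_infty (A : comNzRingType) (g h : series A) (F : nat -> A) :=
  exists (m : nat) (P W : {poly A}),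
    [/\ (size P <= m.+1)%N, (size W <= m.+1)%N, W != 0,
        g * poly_series W = h * poly_series P &
        Series (fun k => if (k <= m)%N then P`_(m - k) else 0) =
        Series F * Series (fun k => if (k <= m)%N then W`_(m - k) else 0)].

(* F i j is F_(i+1),j, for the operator Wr^-1 * bordered_rdet *)
Definition DO_coefs (F : 'I_N -> nat -> Olam) : Prop :=
  forall i : 'I_N, expands_at_infty (dop_coef bordered_rdet (N - i.+1)) Wr (F i).

End OAlgebra.

Definition is_partition (N n : nat) (lam : 'I_N -> nat) : Prop :=
  (forall i j : 'I_N, (i <= j)%N -> (lam j <= lam i)%N) /\
  (\sum_i lam i = n)%N.

(* Main.v *)
(* mu is filtered and injective, and the filtered pieces of O_lam and M_lam have
   the same dimension; hence mu is bijective and preserves degrees.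

   Filtered: B_ij raises the degree in z by at most j - 1.  The operator D^O
   kills f_i; since the K_i are the simple roots of its leading symbol at
   u = oo, comparing the coefficients of u^(lam_i - j - 1) in this equation
   writes f_ij as a combination of products F_kl f_im with m < j and
   (l - 1) + m <= j.  So tau(f_ij) raises the degree by at most j.

   Injective: the kernel of mu is an ideal.  B_1(u) gives the power sums of z,
   so by Newton's identities every symmetric polynomial in z is the action of
   some element of O_lam.  A nonzero G in the kernel is algebraic over these
   n algebraically independent elements, which puts one acting as a nonzero
   polynomial in the kernel, whereas M_lam has no torsion.

   Dimension: an invariant vector of weight lam is determined by its
   coordinate at one basis tensor, a polynomial invariant under the Young
   subgroup S_lam, hence by the coefficients of the monomials that are sorted
   in each block; conjugation of partitions matches them with the monomials
   in the f_ij. *)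
Require Import Defs.
From HB Require Import structures.
From mathcomp Require Import all_boot all_order all_algebra perm.
From mathcomp Require Import boolp reals complex mpoly.

Set Implicit Arguments.
Unset Strict Implicit.
Unset Printing Implicit Defensive.

Import GRing.Theory Num.Theory.
Local Open Scope ring_scope.

(** * Power series and polynomials at infinity *)

Section SeriesDomain.
Variable A : idomainType.
Implicit Types f g h : series A.

Lemma series_neq0P f : f != 0 -> exists2 i, f i != 0 & forall j, (j < i)%N -> f j = 0.
Proof.
move=> f0; have [i fi] : exists i, f i != 0.
  apply: contrapT => nf; case/eqP: f0; apply: seriesP => k /=; rewrite if_same.
  by apply/eqP/negPn/negP => fk; apply: nf; exists k.
exists (ex_minn (ex_intro (fun i => f i != 0) i fi)).
  by case: ex_minnP.
case: ex_minnP => k _ km j jk; apply/eqP/negPn/negP => /km.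
by rewrite leqNgt jk.
Qed.

Lemma series_mulf_neq0 f g : f != 0 -> g != 0 -> f * g != 0.
Proof.
move=> /series_neq0P[i fi fi0] /series_neq0P[j gj gj0].
apply/eqP => /(congr1 (fun h : series A => h (i + j)%N)).
rewrite series_mulEl.
have ilt : (i < (i + j).+1)%N by rewrite ltnS leq_addr.
rewrite (bigD1 (Ordinal ilt)) //= addKn big1 ?addr0.
  by rewrite if_same => /eqP; rewrite mulf_eq0 (negPf fi) (negPf gj).
move=> k; rewrite -val_eqE /= neq_ltn => /orP[ki | ik].
  by rewrite fi0 ?mul0r.
by rewrite gj0 ?mulr0 // ltn_subLR 1?ltn_add2r // -ltnS.
Qed.

Lemma series_mulfI f g h : f != 0 -> f * g = f * h -> g = h.
Proof.
move=> f0 fgh; apply/eqP; rewrite -subr_eq0; apply/negPn/negP => gh.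
by have /eqP[] := series_mulf_neq0 f0 gh; rewrite mulrBr fgh subrr.
Qed.
End SeriesDomain.

Lemma series_sumE (A : nzRingType) I (r : seq I) (P : pred I) (F : I -> series A) k :
  (\sum_(i <- r | P i) F i) k = \sum_(i <- r | P i) F i k.
Proof. by apply: (big_morph (fun f : series A => f k)) => //=; rewrite if_same. Qed.

Section PolySeries.
Variable A : comNzRingType.
Implicit Types p q : {poly A}.

Fact poly_series_nmod : nmod_morphism (@poly_series A).
Proof. by split=> [|p q]; apply: seriesP => k /=; rewrite ?if_same ?coef0 // coefD. Qed.

Fact poly_series_monoid : monoid_morphism (@poly_series A).
Proof.
split=> [|p q]; apply: seriesP => k /=; first by rewrite coef1; case: eqP.
by rewrite coefM.
Qed.

HB.instance Definition _ := GRing.isNmodMorphism.Build _ _ (@poly_series A) poly_series_nmod.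
HB.instance Definition _ := GRing.isMonoidMorphism.Build _ _ (@poly_series A) poly_series_monoid.

Lemma poly_series_inj : injective (@poly_series A).
Proof. by move=> p q pq; apply/polyP => i; rewrite -[LHS]/(poly_series p i) pq. Qed.

(* u^-m p(u), as a power series in u^-1 *)
Definition rev_series m p := Series (fun k => if (k <= m)%N then p`_(m - k) else 0).

Fact rev_series_nmod m : nmod_morphism (rev_series m).
Proof.
split=> [|p q]; apply: seriesP => k /=; first by rewrite coef0 !if_same.
by case: ifP; rewrite ?addr0 // coefD.
Qed.
HB.instance Definition _ m :=
  GRing.isNmodMorphism.Build _ _ (rev_series m) (rev_series_nmod m).

Lemma rev_seriesZXn m a i : (i <= m)%N ->
  rev_series m (a *: 'X^i) = poly_series (a *: 'X^(m - i)).
Proof.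
move=> im; apply: seriesP => k /=; rewrite !coefZ !coefXn.
case: leqP => km; last first.
  case: eqP; rewrite ?mulr0 // => ki.
  by move: km; rewrite ki ltnNge leq_subr.
suff -> : (m - k == i)%N = (k == m - i)%N by [].
apply/eqP/eqP => [<-|->]; by rewrite subKn.
Qed.

(** Under the size bounds nothing is truncated, so both sides are u^-(m+m') p(u) q(u); bilinearity
    reduces this to monomials. *)
Lemma rev_seriesM m m' p q : (size p <= m.+1)%N -> (size q <= m'.+1)%N ->
  rev_series (m + m') (p * q) = rev_series m p * rev_series m' q.
Proof.
have expand l (r : {poly A}) : (size r <= l.+1)%N -> r = \sum_(i < l.+1) r`_i *: 'X^i.
  move=> sr; rewrite -poly_def; apply/polyP => i; rewrite coef_poly.
  by case: ltnP => // li; rewrite nth_default // (leq_trans sr).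
move=> /expand pE /expand qE; rewrite {1}pE {1}qE mulr_suml raddf_sum /=.
rewrite [in RHS]pE raddf_sum mulr_suml; apply: eq_bigr => i _.
rewrite mulr_sumr raddf_sum [in RHS]qE raddf_sum mulr_sumr; apply: eq_bigr => j _ /=.
have im : (i <= m)%N by rewrite -ltnS.
have jm : (j <= m')%N by rewrite -ltnS.
rewrite -scalerAl -scalerAr scalerA -exprD !rev_seriesZXn ?leq_add //.
rewrite -rmorphM /= -scalerAl -scalerAr scalerA -exprD.
congr (poly_series (_ *: 'X^_)).
by rewrite subnDA addnC -addnBA // [RHS]addnC -addnBAC.
Qed.

Lemma rev_series_eq0 m p : (size p <= m.+1)%N -> rev_series m p = 0 -> p = 0.
Proof.
move=> sp p0; apply/polyP => i; rewrite coef0.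
case: (ltnP i m.+1) => im; last by rewrite nth_default // (leq_trans sp).
have /= := congr1 (fun f : series A => f (m - i)%N) p0.
by rewrite leq_subr subKn // if_same.
Qed.
End PolySeries.

(** * Coefficients of differential operators *)

Section DopCoef.
Variables (S : nzRingType) (d : derivation S).
Implicit Types (a b : S) (P Q : dop d).

Fact dop_coefD k : {morph @dop_coef S d ^~ k : P Q / P + Q}.
Proof. by move=> P Q; apply: coefD. Qed.

Lemma dop_coef0 k : dop_coef (0 : dop d) k = 0.
Proof. exact: coef0. Qed.

Lemma dop_coef_funl a P k : dop_coef (dop_fun d a * P) k = a * dop_coef P k.
Proof.
rewrite /dop_coef /= /dmul; have [->|a0] := eqVneq a 0.
  by rewrite size_polyC eqxx big_ord0 coef0 mul0r.
by rewrite size_polyC a0 big_ord1 coefC coefZ.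
Qed.

Lemma dop_coef_Dl P k :
  dop_coef (dop_D d * P) k = (if k is k'.+1 then dop_coef P k' else 0) + d (dop_coef P k).
Proof.
rewrite /dop_coef /= /dmul size_polyX !big_ord_recl big_ord0 /= !coefX scale0r add0r addr0.
rewrite scale1r coefD coefMX coef_poly; case: k => [|k] /=; congr (_ + _);
  by case: ltnP => // sk; rewrite nth_default ?der0.
Qed.

Lemma dop_funM a b : dop_fun d (a * b) = dop_fun d a * dop_fun d b.
Proof.
apply: dopP; apply/polyP => k; rewrite -[RHS]/(dop_coef _ k) dop_coef_funl.
by rewrite /dop_coef /= -coefCM -polyCM.
Qed.

Lemma dop_coef_Dexp j k : dop_coef (dop_D d ^+ j) k = (j == k)%:R.
Proof.
elim: j k => [|j IHj] k; first by rewrite expr0 /dop_coef /= coef1 eq_sym; case: eqP.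
rewrite exprS dop_coef_Dl IHj; case: k => [|k] /=.
  by rewrite add0r; case: eqP => _; rewrite ?der1 ?der0.
by rewrite IHj eqSS; case: (j == k.+1); rewrite ?der1 ?der0 addr0.
Qed.
End DopCoef.

(** * Bordered determinants and their top coefficients *)

Section Border.
Variables (A : comNzRingType) (N : nat).
Implicit Types (q : 'I_N -> nat -> A) (y : nat -> A).

Definition border q y : 'M[A]_N.+1 := \matrix_(i, j)
  if unlift ord_max i is Some i' then q i' j else y j.

Definition border_minor q (k : 'I_N.+1) := \det (\matrix_(i < N, j < N) q i (lift k j)).

Lemma det_border q y :
  \det (border q y) = \sum_(k < N.+1) y k * ((-1) ^+ (N + k) * border_minor q k).
Proof.
rewrite (expand_det_row _ ord_max); apply: eq_bigr => k _.
rewrite mxE unlift_none /cofactor; congr (_ * (_ * \det _)).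
by apply/matrixP => i j; rewrite !mxE liftK.
Qed.

Lemma det_border_dup q i : \det (border q (q i)) = 0.
Proof.
apply: (@determinant_alternate _ _ _ (lift ord_max i) ord_max).
  by rewrite eq_sym neq_lift.
by move=> j; rewrite !mxE liftK unlift_none.
Qed.

(** The powers of D occur only in the last row, hence rightmost in each product of the row
    determinant. No coefficient is ever differentiated, and the commutative expansion applies. *)
Lemma dop_coef_border (d : derivation A) q (k : 'I_N.+1) :
  dop_coef (\det (\matrix_(i < N.+1, j < N.+1)
    if unlift ord_max i is Some i' then dop_fun d (q i' j) else dop_D d ^+ j)) k
  = (-1) ^+ (N + k) * border_minor q k.
Proof.
transitivity (\det (border q (fun j => (j == k)%:R))); last first.
  rewrite det_border (bigD1 k) //= eqxx mul1r big1 ?addr0 // => j jk.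
  by rewrite val_eqE (negPf jk) mul0r.
rewrite /determinant (big_morph _ (dop_coefD k) (dop_coef0 d k)).
apply: eq_bigr => s _; rewrite !big_ord_recr /= !mxE unlift_none.
have sgn : (-1) ^+ s = dop_fun d ((-1) ^+ s) :> dop d.
  case: odd_perm; rewrite ?expr0 ?expr1; apply: dopP => //=.
  by rewrite polyCN.
have wid (i : 'I_N) : widen_ord (leqnSn N) i = lift ord_max i.
  by apply: val_inj; rewrite /= /bump leqNgt ltn_ord.
under eq_bigr do rewrite !mxE wid liftK.
under [in RHS]eq_bigr do rewrite !mxE wid liftK.
rewrite -(big_morph (dop_fun d) (@dop_funM _ d) (erefl : dop_fun d 1 = 1)).
by rewrite sgn mulrA -dop_funM dop_coef_funl dop_coef_Dexp mulrA.
Qed.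
End Border.

Lemma border_minor_scale (A : comNzRingType) N (e : 'I_N -> series A)
    (p : 'I_N -> nat -> {poly A}) (k : 'I_N.+1) :
  border_minor (fun i j => e i * poly_series (p i j)) k =
  (\prod_i e i) * poly_series (border_minor p k).
Proof.
rewrite /border_minor -det_map_mx.
rewrite (_ : \prod_i e i = \det (diag_mx (\row_i e i))); last first.
  by rewrite det_diag; apply: eq_bigr => i _; rewrite mxE.
rewrite -det_mulmx; congr (\det _); apply/matrixP => i j.
by rewrite mul_diag_mx !mxE.
Qed.

Lemma coefM_top (A : comNzRingType) m m' (p q : {poly A}) :
  (size p <= m.+1)%N -> (size q <= m'.+1)%N ->
  (size (p * q)%R <= (m + m').+1)%N /\ (p * q)`_(m + m') = p`_m * q`_m'.
Proof.
move=> sp sq; split.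
  rewrite (leq_trans (size_polyMleq p q)) //.
  by rewrite -subn1 leq_subLR add1n -addnS -addSn leq_add.
have := congr1 (fun f : series A => f 0%N) (rev_seriesM sp sq).
by rewrite series_mulEl big_ord1 /= !subn0.
Qed.

(** Row i has degree at most [l i], so in every product of the expansion the top coefficients simply
    multiply. *)
Lemma det_top (A : comNzRingType) N (l : 'I_N -> nat) (M : 'M[{poly A}]_N) :
  (forall i j, size (M i j) <= (l i).+1)%N ->
  (size (\det M) <= (\sum_i l i).+1)%N /\
  (\det M)`_(\sum_i l i) = \det (\matrix_(i, j) (M i j)`_(l i)).
Proof.
move=> sM.
have topM s : (size (\prod_i M i (s i))%R <= (\sum_i l i).+1)%N /\
    (\prod_i M i (s i))`_(\sum_i l i) = \prod_i (M i (s i))`_(l i).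
  elim/big_rec3: _ => [|i x y z _ [sz zy]]; first by rewrite size_poly1 coef1.
  by have [] := coefM_top (sM i (s i)) sz; rewrite zy; split.
have sgnE (s : 'S_N) : (-1) ^+ s = ((-1) ^+ s)%:P :> {poly A}.
  by rewrite rmorphXn rmorphN1.
split.
  rewrite /determinant (leq_trans (size_sum _ _ _)) //; apply/bigmax_leqP => s _.
  by rewrite sgnE mul_polyC (leq_trans (size_scale_leq _ _)) // (topM s).1.
rewrite /determinant coef_sum; apply: eq_bigr => s _.
by rewrite sgnE coefCM (topM s).2; congr (_ * _); apply: eq_bigr => i _; rewrite mxE.
Qed.

(** * The operator annihilating the quasi-exponentials *)

Section Infinity.
Variables (C : numFieldType) (N : nat) (K : 'I_N -> C) (lam : 'I_N -> nat).
Local Notation A := (Olam C lam).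

Definition quasi_poly (i : 'I_N) : {poly A} :=
  'X^(lam i) + \sum_(j < lam i) (Ovar C j) *: 'X^(lam i - j.+1).

(* e^(-cu) d/du (e^(cu) p) *)
Definition twist (c : C) (p : {poly A}) : {poly A} := p^`() + c%:MP *: p.

Definition twisted_der (i : 'I_N) (k : nat) := iter k (twist (K i)) (quasi_poly i).

Lemma coef_twist c p m : (twist c p)`_m = p`_m.+1 *+ m.+1 + c%:MP * p`_m.
Proof. by rewrite coefD coef_deriv coefZ. Qed.

(** Splitting off e^(K_i u) turns the rows of the Wronskian into polynomials; the exponentials
    cancel later in the ratio. *)
Lemma quasi_exp_derE i k :
  quasi_exp_der K lam i k = exp_series lam (K i) * poly_series (twisted_der i k).
Proof.
elim: k => [|k IHk] //; rewrite /quasi_exp_der iterS -/(quasi_exp_der K lam i k) IHk derM.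
have -> : series_ddu A (exp_series lam (K i)) =
    exp_series lam (K i) * poly_series (K i)%:MP%:P.
  rewrite mulrC; apply: seriesP => m.
  rewrite series_mulEl big_ord_recl big1 ?addr0 => [|j _]; last first.
    by rewrite /= coefC mul0r.
  rewrite /= coefC /= subn0 -mpolyCM -mpolyCMn; congr (_%:MP).
  rewrite factS natrM invfM exprS -[LHS]mulr_natr -!mulrA; congr (_ * (_ * _)).
  by rewrite mulrCA mulVf ?mulr1 // pnatr_eq0.
have -> : series_ddu A (poly_series (twisted_der i k)) =
    poly_series (twisted_der i k)^`().
  by apply: seriesP => m; rewrite /= coef_deriv.
rewrite -mulrA -mulrDr -rmorphM -rmorphD; congr (_ * poly_series _).
by rewrite mul_polyC addrC.
Qed.

Lemma exp_series_neq0 (c : C) : exp_series lam c != 0.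
Proof.
apply/eqP => /(congr1 (fun f : series A => f 0%N))/eqP.
by rewrite /= expr0 fact0 divr1 oner_eq0.
Qed.

(* f_(i+1),m, with f_(i+1),0 = 1 and f_(i+1),m = 0 for m > lam i *)
Definition fcoef (i : 'I_N) (m : nat) : A :=
  if m is j.+1 then (if insub j is Some o then Ovar C (o : 'I_(lam i)) else 0) else 1.

Lemma coef_quasi_poly i m : (m <= lam i)%N ->
  (quasi_poly i)`_(lam i - m) = fcoef i m.
Proof.
move=> mi; rewrite coefD coefXn coef_sum.
under eq_bigr do rewrite coefZ coefXn.
case: m mi => [|j] ji.
  rewrite subn0 eqxx big1 ?addr0 // => j _.
  rewrite gtn_eqF ?mulr0 //.
  by rewrite ltn_subrL; case: (lam i) j => [[]|].
rewrite [_ == lam i]ltn_eqF ?add0r; last by rewrite ltn_subrL (leq_trans _ ji).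
rewrite /fcoef insubT /= (bigD1 (Ordinal ji)) //= eqxx mulr1 big1 ?addr0 //.
move=> o; rewrite -val_eqE /= => oj; rewrite (_ : (_ == _) = false) ?mulr0 //.
apply/eqP => jo; case/eqP: oj.
have := congr1 (fun x => lam i - x)%N jo.
by rewrite /= !subKn // => -[].
Qed.

Lemma size_twisted_der i k : (size (twisted_der i k) <= (lam i).+1)%N.
Proof.
elim: k => [|k IHk].
  apply/leq_sizeP => m mi; rewrite coefD coefXn gtn_eqF // add0r coef_sum big1 // => j _.
  by rewrite coefZ coefXn gtn_eqF ?mulr0 // (leq_ltn_trans (leq_subr _ _)).
apply/leq_sizeP => m mi.
by rewrite [twisted_der _ _]iterS coef_twist !(leq_sizeP _ _ IHk) ?mulr0 ?mul0rn ?addr0 // ltnW.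
Qed.

(** Differentiation lowers the degree, so at the top power only the multiplication by K_i acts. *)
Lemma lead_twisted_der i k : (twisted_der i k)`_(lam i) = (K i ^+ k)%:MP.
Proof.
elim: k => [|k IHk].
  by have /= := coef_quasi_poly (leq0n (lam i)); rewrite subn0.
rewrite [twisted_der _ _]iterS coef_twist IHk (leq_sizeP _ _ (size_twisted_der i k)) //.
by rewrite mul0rn add0r -mpolyCM exprS.
Qed.

Lemma top_border_minor (k : 'I_N.+1) :
  (size (border_minor twisted_der k) <= (\sum_i lam i).+1)%N /\
  (border_minor twisted_der k)`_(\sum_i lam i) =
    \det (\matrix_(i < N, j < N) (K i ^+ lift k j)%:MP).
Proof.
have [|? ->] := @det_top A N lam (\matrix_(i < N, j < N) twisted_der i (lift k j)).
  by move=> i j; rewrite mxE size_twisted_der.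
by split=> //; congr (\det _); apply/matrixP => i j; rewrite !mxE lead_twisted_der.
Qed.

Lemma size_signed_minor (k : 'I_N.+1) :
  (size ((-1) ^+ (N + k) * border_minor twisted_der k)%R <= (\sum_i lam i).+1)%N.
Proof.
rewrite (_ : (-1) ^+ _ = ((-1) ^+ (N + k))%:P :> {poly A}).
  by rewrite mul_polyC (leq_trans (size_scale_leq _ _)) // (top_border_minor _).1.
by rewrite rmorphXn rmorphN1.
Qed.

Lemma Wr_minor : Wr K lam = (\prod_i exp_series lam (K i)) *
  poly_series (border_minor twisted_der ord_max).
Proof.
rewrite -border_minor_scale /border_minor; congr (\det _); apply/matrixP => i j.
by rewrite !mxE quasi_exp_derE /= /bump leqNgt ltn_ord.
Qed.

Lemma dop_coef_bordered_rdet (k : 'I_N.+1) :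
  dop_coef (bordered_rdet K lam) k = (\prod_i exp_series lam (K i)) *
    poly_series ((-1) ^+ (N + k) * border_minor twisted_der k).
Proof.
rewrite dop_coef_border.
have -> : border_minor (quasi_exp_der K lam) k = border_minor
    (fun i j => exp_series lam (K i) * poly_series (twisted_der i j)) k.
  by congr (\det _); apply/matrixP => i j; rewrite !mxE quasi_exp_derE.
by rewrite border_minor_scale mulrCA rmorphM rmorphXn rmorphN1.
Qed.

Hypothesis K_inj : injective K.

(** This coefficient is the Vandermonde determinant of the distinct K_i. *)
Lemma Wr_lead_neq0 : (border_minor twisted_der ord_max)`_(\sum_i lam i) != 0.
Proof.
rewrite (top_border_minor ord_max).2.
rewrite (_ : \matrix_(_, _) _ = map_mx (@mpolyC _ C) (Vandermonde N (\row_i K i))^T); last first.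
  by apply/matrixP => i j; rewrite !mxE /= /bump leqNgt ltn_ord.
rewrite det_map_mx mpolyC_eq0 det_tr det_Vandermonde.
apply/prodf_neq0 => i _; apply/prodf_neq0 => j ij; rewrite !mxE subr_eq0.
by apply: contraTneq ij => /K_inj ->; rewrite ltnn.
Qed.

Variable F : 'I_N -> nat -> A.
Hypothesis F_coefs : DO_coefs K F.

(* The coefficient of D^k in the monic operator D^N + sum_i F_i(u) D^(N-i) *)
Definition Fser (k : 'I_N.+1) : series A :=
  if unlift ord_max k is Some k' then Series (F (rev_ord k')) else 1.

(** The pair [P], [W] given by the expansion need not consist of the minors themselves. Once the
    exponentials are cancelled, cross-multiplication by [W] transfers the expansion to the
    minors. *)
Lemma Fser_minor (k : 'I_N.+1) :
  rev_series (\sum_i lam i) ((-1) ^+ (N + k) * border_minor twisted_der k) =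
  Fser k * rev_series (\sum_i lam i) (border_minor twisted_der ord_max).
Proof.
rewrite /Fser; case: unliftP => [k'|] ->; last first.
  by rewrite /= -signr_odd addnn odd_double expr0 !mul1r.
have [m [P [W [sP sW W0 gWhP PFW]]]] := F_coefs (rev_ord k').
have kE : (N - (rev_ord k').+1)%N = lift ord_max k'.
  by rewrite /= /bump leqNgt ltn_ord /= -subSn // subSS subKn // ltnW.
rewrite kE dop_coef_bordered_rdet Wr_minor -!mulrA in gWhP.
have E0 : \prod_i exp_series lam (K i) != 0.
  by elim/big_rec: _ => [|i x _ x0]; rewrite ?oner_neq0 // series_mulf_neq0 // exp_series_neq0.
have {gWhP} := series_mulfI E0 gWhP; rewrite -!rmorphM => /poly_series_inj.
set G := (-1) ^+ _ * _ => GW.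
have sG : (size G <= (\sum_i lam i).+1)%N by apply: size_signed_minor.
have W'0 : rev_series m W != 0.
  by apply: contraNneq W0 => /(rev_series_eq0 sW) ->.
apply: (series_mulfI W'0); rewrite mulrC -rev_seriesM // GW.
have PW : rev_series m P = Series (F (rev_ord k')) * rev_series m W by [].
rewrite rev_seriesM ?(top_border_minor _).1 // PW mulrCA [RHS]mulrCA; congr (_ * _); apply: mulrC.
Qed.

(* D^N + sum_i F_i D^(N-i) kills f_i *)
Lemma Fser_twisted_der i :
  \sum_(k < N.+1) Fser k * rev_series (lam i) (twisted_der i k) = 0.
Proof.
have H0 : rev_series (\sum_i lam i) (border_minor twisted_der ord_max) != 0.
  apply: contraNneq Wr_lead_neq0 => /(congr1 (fun f : series A => f 0%N)) /=.
  by rewrite subn0 => ->.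
apply: (series_mulfI H0); rewrite mulr0 mulr_sumr.
(* After multiplication by the Wronskian, the sum becomes the determinant bordered by its own row i,
   which has two equal rows. *)
have := det_border_dup twisted_der i.
rewrite det_border => /(congr1 (rev_series (lam i + \sum_i lam i))).
rewrite raddf0 raddf_sum /= => {2}<-; apply: eq_bigr => k _.
rewrite rev_seriesM ?size_twisted_der ?size_signed_minor // Fser_minor mulrCA [RHS]mulrCA; congr (_ * _); apply: mulrC.
Qed.
End Infinity.

(** * Monic polynomials with prescribed simple roots *)

Section ProdXsubC.
Variables (A : idomainType) (I : finType) (a : I -> A).

Lemma horner_prod_XsubC i : (\prod_l ('X - (a l)%:P)).[a i] = 0.
Proof. by rewrite horner_prod (bigD1 i) //= hornerXsubC subrr mul0r. Qed.

Lemma deriv_prod_XsubC i :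
  (\prod_l ('X - (a l)%:P))^`().[a i] = \prod_(l | l != i) (a i - a l).
Proof.
rewrite (bigD1 i) //= derivM derivXsubC mul1r hornerD hornerM hornerXsubC.
rewrite subrr mul0r addr0 horner_prod; apply: eq_bigr => l _.
by rewrite hornerXsubC.
Qed.

Lemma monic_prod_XsubC_roots (p : {poly A}) : injective a ->
  (size p <= #|I|.+1)%N -> p`_#|I| = 1 -> (forall i, p.[a i] = 0) ->
  p = \prod_i ('X - (a i)%:P).
Proof.
move=> a_inj sp p1 pa; apply/eqP; rewrite -subr_eq0; set D := p - _.
apply/negPn/negP => nz.
have us : uniq [seq a i | i <- enum I] by rewrite map_inj_uniq ?enum_uniq.
have rs : all (root D) [seq a i | i <- enum I].
  apply/allP => _ /mapP[i _ ->].
  by rewrite rootE hornerD hornerN pa horner_prod_XsubC subr0.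
have sz : size (\prod_i ('X - (a i)%:P))%R = #|I|.+1.
  by rewrite size_prod_XsubC /index_enum -enumT -cardE.
have := max_poly_roots nz rs us; rewrite size_map -cardE ltnNge => /negP; apply.
apply/leq_sizeP => j; rewrite leq_eqVlt => /orP[/eqP<- | Nj].
  have /monicP := monic_prod_XsubC (index_enum I) xpredT a.
  by rewrite lead_coefE sz /= coefB => ->; rewrite p1 subrr.
by rewrite coefB !nth_default ?subrr ?sz ?(leq_trans sp).
Qed.
End ProdXsubC.

(** * Solving the differential equation at infinity for the f_ij *)

Section FilteredCoefficients.
Variables (C : numFieldType) (N : nat) (K : 'I_N -> C) (lam : 'I_N -> nat).
Local Notation A := (Olam C lam).
Hypothesis K_inj : injective K.
Variable F : 'I_N -> nat -> A.
Hypothesis F_coefs : DO_coefs K F.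

Local Notation Fk := (Fser F).
Local Notation T i k := (rev_series (lam i) (twisted_der K lam i k)).

(* d/du on the coefficients of u^(l-m), where u^l is the top power *)
Definition lower (l : nat) (g : nat -> A) (m : nat) : A :=
  if m is m'.+1 then g m' *+ (l - m') else 0.

Lemma rev_twisted0 i m : T i 0 m = fcoef C lam i m.
Proof.
rewrite /=; case: leqP => mi; first by rewrite coef_quasi_poly.
by case: m mi => // m mi; rewrite /fcoef insubF // ltnNge -ltnS mi.
Qed.

(** This is [twist] read on coefficients counted from the top power, so that [T i k] is (K_i + E)^k
    f with E = [lower (lam i)]. *)
Lemma rev_twistedS i k m :
  T i k.+1 m = (K i)%:MP * T i k m + lower (lam i) (T i k) m.
Proof.
rewrite /= -/(twisted_der K lam i k); case: leqP => mi; last first.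
  rewrite mulr0 add0r; case: m mi => // m mi /=.
  by rewrite (_ : lam i - m = 0)%N ?mulr0n //; apply/eqP; rewrite subn_eq0.
rewrite coef_twist addrC; congr (_ + _); case: m mi => [|m] mi /=.
  by rewrite subn0 nth_default ?mul0rn // size_twisted_der.
by rewrite -subSn // subSS (ltnW mi).
Qed.

Lemma lowerD l g h m : lower l (fun m => g m + h m) m = lower l g m + lower l h m.
Proof. by case: m => [|m] /=; rewrite ?addr0 // mulrnDl. Qed.

Lemma lowerZ l c g m : lower l (fun m => c * g m) m = c * lower l g m.
Proof. by case: m => [|m] /=; rewrite ?mulr0 // mulrnAr. Qed.

Lemma eq_lower l g h m : g =1 h -> lower l g m = lower l h m.
Proof. by move=> gh; case: m => //= m; rewrite gh. Qed.

(** The leading symbol of the operator at u = oo. *)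
Definition indicial : {poly A} := \poly_(k < N.+1) (Fk (inord k) 0%N).

(** The top coefficient of the equation killing f_i makes K_i a root; the polynomial is monic of
    degree N and the K_i are distinct. *)
Lemma indicialE : indicial = \prod_i ('X - (K i)%:MP%:P).
Proof.
apply: monic_prod_XsubC_roots.
- by move=> i j /eqP; rewrite mpolyC_eq => /eqP /K_inj.
- by rewrite card_ord size_poly.
- rewrite card_ord coef_poly ltnSn (_ : inord N = ord_max).
    by rewrite /Fser unlift_none.
  by apply: val_inj; rewrite /= inordK.
move=> i; rewrite horner_poly.
have /(congr1 (fun f : series A => f 0%N)) := Fser_twisted_der K_inj F_coefs i.
rewrite series_sumE /= => Fi; rewrite -[RHS](if_same true) -[RHS]Fi.
apply: eq_bigr => k _; rewrite big_ord1 /= !subn0 lead_twisted_der rmorphXn /=.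
by rewrite inord_val.
Qed.

Lemma indicial_root i : indicial.[(K i)%:MP] = 0.
Proof. by rewrite indicialE (horner_prod_XsubC (fun i => (K i)%:MP)). Qed.

Lemma indicial_deriv i : exists2 c : C, c != 0 & indicial^`().[(K i)%:MP] = c%:MP.
Proof.
exists (\prod_(l | l != i) (K i - K l)).
  by apply/prodf_neq0 => l li; rewrite subr_eq0 (inj_eq K_inj) eq_sym.
rewrite indicialE (deriv_prod_XsubC (fun i => (K i)%:MP)) rmorph_prod.
by apply: eq_bigr => l _; rewrite rmorphB.
Qed.

(** An abstract increasing multiplicative filtration, instantiated later by [tau_raises]. The
    predecessor in [filF] is truncated, so F_i0 and F_i1 both lie in [fil 0]. *)
Variable fil : nat -> A -> Prop.
Hypothesis fil_le : forall d e x, (d <= e)%N -> fil d x -> fil e x.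
Hypothesis filD : forall d x y, fil d x -> fil d y -> fil d (x + y).
Hypothesis filM : forall d e x y, fil d x -> fil e y -> fil (d + e) (x * y).
Hypothesis filC : forall c, fil 0 c%:MP.
Hypothesis filF : forall i l, fil l.-1 (F i l).

Lemma filCM d c x : fil d x -> fil d (c%:MP * x).
Proof. exact: filM (filC c). Qed.

Lemma fil0 d : fil d 0.
Proof. by apply: (@fil_le 0) => //; rewrite -(@mpolyC0 _ C). Qed.

Lemma filMn d x m : fil d x -> fil d (x *+ m).
Proof. by rewrite -mulr_natl -mpolyC_nat; apply: filCM. Qed.

Lemma fil_sum d (I : finType) (G : I -> A) : (forall i, fil d (G i)) -> fil d (\sum_i G i).
Proof. by move=> dG; elim/big_ind: _ => //; [apply: fil0 | apply: filD]. Qed.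

Lemma filFk k l : fil l.-1 (Fk k l).
Proof.
rewrite /Fser; case: unlift => [k'|]; first exact: filF.
by case: l => [|l]; [rewrite -[Series _ _]/1 -(mpolyC1 _ C) | apply: fil0].
Qed.

(** [lower] shifts the index by one, so bounds at indices below j yield bounds up to j itself. *)
Lemma fil_lower l g j : (forall m, (m < j)%N -> fil m (g m)) ->
  forall m, (m <= j)%N -> fil m (lower l g m).
Proof.
move=> gj [|m] mj; first exact: fil0.
by apply: filMn; apply: (fil_le (leqnSn m)); apply: gj.
Qed.

Section Step.
Variables (i : 'I_N) (j : nat).
Hypothesis IHj : forall m, (m < j)%N -> fil m (fcoef C lam i m).
Local Notation f := (fcoef C lam i).
Local Notation E := (lower (lam i)).

Lemma fil_T k m : (m < j)%N -> fil m (T i k m).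
Proof.
elim: k m => [|k IHk] m mj; first by rewrite rev_twisted0; apply: IHj.
rewrite rev_twistedS; apply: filD; first by apply: filCM; apply: IHk.
by apply: (@fil_lower _ _ m) => // m' m'm; apply: IHk; apply: ltn_trans mj.
Qed.

(* (K + E)^k f up to terms of order two in E *)
Lemma T_expand k : exists2 S : nat -> A, (forall m, (m < j)%N -> fil m (S m)) &
  forall m, T i k m = (K i ^+ k)%:MP * f m + (K i ^+ k.-1 *+ k)%:MP * E f m + E (E S) m.
Proof.
elim: k => [|k [S filS TS]].
  exists (fun=> 0) => [m _|m]; first exact: fil0.
  rewrite rev_twisted0 expr0 mulr0n mpolyC1 mpolyC0 mul1r mul0r addr0.
  by case: m => [|[|m]] /=; rewrite ?mul0rn ?addr0.
(* Applying K + E to the expansion of order k leaves exactly three terms with a factor E^2: from K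
   times the old remainder, from E times the linear term, and from E times the old remainder. *)
exists (fun m => (K i)%:MP * S m + ((K i ^+ k.-1 *+ k)%:MP * f m + E S m)) => [m mj|m].
  apply: filD; first by apply: filCM; apply: filS.
  apply: filD; first by apply: filCM; apply: IHj.
  by apply: (@fil_lower _ _ m) => // m' m'm; apply: filS; apply: ltn_trans mj.
rewrite rev_twistedS TS (eq_lower _ _ TS) !lowerD !lowerZ.
rewrite (eq_lower (lam i) m (fun m' => lowerD (lam i) _ _ m')) lowerD.
rewrite (eq_lower (lam i) m (fun m' => lowerZ (lam i) _ _ m')) lowerZ.
rewrite (eq_lower (lam i) m (fun m' => lowerD (lam i) _ _ m')) lowerD.
rewrite (eq_lower (lam i) m (fun m' => lowerZ (lam i) _ _ m')) lowerZ.
have -> : (K i ^+ k.+1.-1 *+ k.+1)%:MP = (K i ^+ k)%:MP + (K i)%:MP * (K i ^+ k.-1 *+ k)%:MP :> A.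
  rewrite -mpolyCM -mpolyCD mulrnAr; case: k {S filS TS} => [|k] /=; first by rewrite addr0.
  by rewrite -exprS -mulrS.
rewrite exprS mpolyCM !mulrDr !mulrDl -!mulrA -!addrA; congr (_ + _).
by rewrite [RHS]addrCA; congr (_ + _); rewrite [LHS]addrCA.
Qed.

(** The terms with f_(i,j+1) and f_ij that decide the recursion are displayed; [r] collects the
    products with f_im for m < j, all of weight at most j. *)
Lemma coef_step (k : 'I_N.+1) : (0 < j)%N -> exists2 r, fil j r &
  (Fk k * T i k) j.+1 = Fk k 0%N * (K i ^+ k)%:MP * f j.+1
    + Fk k 0%N * (K i ^+ k.-1 *+ k)%:MP * (f j *+ (lam i - j))
    + Fk k 1%N * (K i ^+ k)%:MP * f j + r.
Proof.
move=> j0; have [S filS TS] := T_expand k.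
have filES : forall m, (m <= j)%N -> fil m (E S m) by apply: fil_lower.
exists (Fk k 0%N * (E (E S) j.+1) +
    Fk k 1%N * ((K i ^+ k.-1 *+ k)%:MP * E f j + E (E S) j) +
    \sum_(l < j) Fk k l.+2 * T i k (j - l.+1)%N).
  apply: filD; first apply: filD.
  - by apply: (filM (filFk k 0)); apply: filMn; apply: filES.
  - apply: (filM (filFk k 1)); apply: filD.
      by apply: filCM; apply: fil_lower (leqnn j).
    by apply: fil_lower (leqnn j) => m mj; apply: filES; apply: ltnW.
  (* The factor from F has weight l + 1 and the one from T has weight j - l - 1. *)
  apply: fil_sum => l; rewrite -{1}(subnKC (ltn_ord l)).
  by apply: (filM (filFk k l.+2)); apply: fil_T; rewrite ltn_subrL j0.
rewrite series_mulEl !big_ord_recl [nat_of_ord ord0]/= (_ : (lift ord0 ord0 : nat) = 1%N) //.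
rewrite subn0 subn1 [j.+1.-1]/= !TS.
rewrite !mulrDr !mulrA -!addrA; congr (_ + (_ + _)).
by rewrite [LHS]addrCA.
Qed.
End Step.

(** In the coefficient of u^(lam i - j - 1) of the equation, f_(i,j+1) is multiplied by the value of
    [indicial] at K_i, which is 0, and f_ij by -c j, where c is the nonzero derivative of [indicial]
    at K_i. So f_ij can be solved for. *)
Lemma fcoef_fil i m : (m <= lam i)%N -> fil m (fcoef C lam i m).
Proof.
elim/ltn_ind: m => j IH ji; have [->|j0] := posnP j; first by rewrite /= -(mpolyC1 _ C).
have IHj m : (m < j)%N -> fil m (fcoef C lam i m).
  by move=> mj; apply: IH => //; apply: leq_trans ji; apply: ltnW.
have [r filr rE] := fin_all_exists2 (fun k => coef_step IHj k j0).
have [c c0 cE] := indicial_deriv i.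
have indE (x : A) : indicial.[x] = \sum_(k < N.+1) Fk k 0%N * x ^+ k.
  by rewrite horner_poly; apply: eq_bigr => k _; rewrite inord_val.
have S0 : \sum_(k < N.+1) Fk k 0%N * (K i ^+ k)%:MP = 0.
  under eq_bigr do rewrite rmorphXn /=.
  by rewrite -indE indicial_root.
have S1 : \sum_(k < N.+1) Fk k 0%N * (K i ^+ k.-1 *+ k)%:MP = c%:MP.
  rewrite -cE /indicial poly_def (raddf_sum (@deriv A)) /= horner_sum; apply: eq_bigr => k _.
  by rewrite derivZ derivXn hornerZ hornerMn hornerXn inord_val rmorphMn rmorphXn.
have coefE m' : \sum_(k < N.+1) (Fk k * T i k) m' = 0.
  by rewrite -series_sumE Fser_twisted_der //= if_same.
(* The equation at index 1 determines this sum: f_i1 drops out by [S0], and E f contributes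
   lam_i. *)
have S2 : \sum_(k < N.+1) Fk k 1%N * (K i ^+ k)%:MP = - (c%:MP *+ lam i).
  have eq1 k : (Fk k * T i k) 1%N = Fk k 0%N * (K i ^+ k)%:MP * fcoef C lam i 1
      + Fk k 0%N * (K i ^+ k.-1 *+ k)%:MP *+ lam i + Fk k 1%N * (K i ^+ k)%:MP.
    have [//|S _ TS] := @T_expand i 0 _ k.
    rewrite series_mulEl !big_ord_recl big_ord0 addr0.
    rewrite [nat_of_ord ord0]/= (_ : (lift ord0 ord0 : nat) = 1%N) //.
    rewrite subn0 subn1 [1.-1]/= !TS /lower subn0 mul0rn mulr0 !addr0 mulr1.
    by rewrite mulrDr mulrA (_ : fcoef C lam i 0 = 1) // mulr_natr -mulrnAr.
  have := coefE 1%N; under eq_bigr do rewrite eq1.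
  rewrite !big_split /= -!mulr_suml S0 mul0r add0r sumrMnl S1 => /eqP.
  by rewrite addrC addr_eq0 => /eqP.
have := coefE j.+1; under eq_bigr do rewrite rE.
rewrite !big_split /= -!mulr_suml S0 S1 S2 mul0r add0r mulNr => eq0.
(* The total coefficient of f_ij is c (lam_i - j) - c lam_i = -c j. *)
have jc : (c *+ j)%:MP * fcoef C lam i j = \sum_(k < N.+1) r k.
  move/eqP: eq0; rewrite addrC addr_eq0 opprB => /eqP ->.
  by rewrite mpolyCMn mulrnAr -mulrnAl -mulrBl -mulrnBr ?leq_subr // subKn.
have jc0 : c *+ j != 0 by rewrite -mulr_natl mulf_neq0 ?pnatr_eq0 -?lt0n.
rewrite -[fcoef _ _ _ _]mul1r -(mpolyC1 _ C) -(mulVf jc0) mpolyCM -mulrA jc.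
by apply: filCM; apply: fil_sum.
Qed.
End FilteredCoefficients.

(** * Degrees of the Bethe generators *)

Lemma msizeM_leD n (R : nzRingType) d e (p q : {mpoly R[n]}) :
  (msize p <= d.+1)%N -> (msize q <= e.+1)%N -> (msize (p * q) <= (d + e).+1)%N.
Proof.
move=> pd qe; rewrite msizeE; apply/bigmax_leqP_seq => m /msuppM_le/allpairsP.
case=> -[m1 m2] /= [m1p m2q ->] _; rewrite mdegD ltnS leq_add // -ltnS.
  exact: leq_trans (msize_mdeg_lt m1p) pd.
exact: leq_trans (msize_mdeg_lt m2q) qe.
Qed.

Section TensorDegree.
Variables (C : comNzRingType) (N n : nat).
Implicit Types (w : tensmod C N n) (x y : Uglt C N).

Definition tens_le e w := forall a, (msize (w a) <= e.+1)%N.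

Lemma tens_degP e w : reflect (tens_le e w) (tens_deg w <= e)%N.
Proof.
apply: (iffP idP) => [/bigmax_leqP we a | we].
  rewrite msizeE; apply/bigmax_leqP_seq => m mw _; rewrite ltnS.
  by have /bigmax_leqP_seq := we a isT; apply.
apply/bigmax_leqP => a _; apply/bigmax_leqP_seq => m mw _.
by rewrite -ltnS (leq_trans _ (we a)) // msize_mdeg_lt.
Qed.

Lemma tens_leW e e' w : (e <= e')%N -> tens_le e w -> tens_le e' w.
Proof. by move=> ee' we a; apply: leq_trans (we a) _. Qed.

Lemma tens_le0 e : tens_le e 0.
Proof. by move=> a; rewrite ffunE msize0. Qed.

Lemma tens_leD e w w' : tens_le e w -> tens_le e w' -> tens_le e (w + w').
Proof.
move=> we w'e a; rewrite ffunE (leq_trans (msizeD_le _ _)) //.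
by rewrite geq_max we w'e.
Qed.

Lemma tens_leZ e c w : tens_le e w -> tens_le e (c *: w).
Proof. by move=> we a; rewrite ffunE (leq_trans (msizeZ_le _ _)). Qed.

Definition raises d x := forall e w, tens_le e w -> tens_le (e + d) (U_act n x w).

Lemma raisesW d d' x : (d <= d')%N -> raises d x -> raises d' x.
Proof. by move=> dd' dx e w we; apply: tens_leW (dx _ _ we); rewrite leq_add2l. Qed.

Lemma raisesD d x y : raises d x -> raises d y -> raises d (x + y).
Proof. by move=> dx dy e w we; rewrite raddfD; apply: tens_leD; [apply: dx | apply: dy]. Qed.

Lemma raisesZ d c x : raises d x -> raises d (c *: x).
Proof. by move=> dx e w we; rewrite linearZ; apply: tens_leZ; apply: dx. Qed.

Lemma raises0 d : raises d 0.
Proof. by move=> e w _; rewrite raddf0; apply: tens_le0. Qed.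

Lemma raises1 : raises 0 1.
Proof. by move=> e w we; rewrite rmorph1 addn0. Qed.

Lemma raisesM d d' x y : raises d x -> raises d' y -> raises (d + d') (x * y).
Proof.
move=> dx dy e w we; rewrite rmorphM [(d + d')%N]addnC addnA.
by apply: dx; apply: dy.
Qed.

Lemma raises_sum d (I : finType) (G : I -> Uglt C N) :
  (forall i, raises d (G i)) -> raises d (\sum_i G i).
Proof. by move=> dG; elim/big_ind: _ => //; [apply: raises0 | apply: raisesD]. Qed.

Lemma U_act_gen g r w : U_act n (U_gen (glt_tensor g r)) w =
  \sum_s [ffun a : {ffun 'I_n -> 'I_N} =>
    'X_s ^+ r * factor_act s (map_mx (@mpolyC n C) g) w a].
Proof. by rewrite /U_act (U_lift_gen (glt_end_lie C N n)) [LHS]glt_act_tensor. Qed.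

Lemma raises_gen g r : raises r (U_gen (glt_tensor g r)).
Proof.
move=> e w we; rewrite U_act_gen.
elim/big_ind: _ => [||s _]; [exact: tens_le0 | exact: tens_leD |] => a.
rewrite !ffunE mulr_sumr (leq_trans (msize_sum _ _ _)) //.
apply/bigmax_leqP => j _; rewrite mxE mulrCA mul_mpolyC.
rewrite (leq_trans (msizeZ_le _ _)) //.
by rewrite [(e + r)%N]addnC msizeM_leD // mpolyXn msizeX mdegMn mdeg1 mul1n.
Qed.

(** The bound k - 1, truncated at 0, fits g(u), whose coefficient of u^-(r+1) is g (x) t^r. *)
Definition series_raises (f : series (Uglt C N)) := forall k, raises k.-1 (f k).

Lemma series_raises0 : series_raises 0.
Proof. by move=> k; rewrite /= if_same; apply: raises0. Qed.

Lemma series_raises1 : series_raises 1.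
Proof. by case=> [|k]; [apply: raises1 | apply: raises0]. Qed.

Lemma series_raisesD f g : series_raises f -> series_raises g -> series_raises (f + g).
Proof. by move=> ff gg k; apply: raisesD; [apply: ff | apply: gg]. Qed.

Lemma series_raisesN f : series_raises f -> series_raises (- f).
Proof. by move=> ff k; rewrite /= -scaleN1r; apply: raisesZ; apply: ff. Qed.

Lemma series_raisesM f g : series_raises f -> series_raises g -> series_raises (f * g).
Proof.
move=> ff gg k; rewrite series_mulEl; apply: raises_sum => j.
apply: raisesW (raisesM (ff j) (gg (k - j)%N)).
have := ltn_ord j; rewrite ltnS => jk.
(* For j = 0 the truncated bounds add up to exactly k - 1; for j > 0 the first factor already saves
   one. *)
case: (nat_of_ord j) jk => [|j'] jk; first by rewrite subn0.
by rewrite -[in k.-1](subnKC jk) addSn /= leq_add2l leq_pred.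
Qed.

Lemma series_raises_der f : series_raises f -> series_raises (series_inv_ddu _ f).
Proof.
move=> ff k; rewrite /= -scaleN1r; apply: raisesZ; rewrite -scaler_nat.
by apply: raisesZ; apply: raisesW (ff _); apply: leq_pred.
Qed.

Definition dop_raises (P : Bethe_dop C N) := forall i, series_raises (dop_coef P i).

Lemma dop_raises_sum I (r : seq I) (G : I -> Bethe_dop C N) :
  (forall i, dop_raises (G i)) -> dop_raises (\sum_(i <- r) G i).
Proof.
move=> dG; elim/big_ind: _ => // [|P Q dP dQ] i.
  by rewrite dop_coef0; apply: series_raises0.
by rewrite dop_coefD; apply: series_raisesD.
Qed.

Lemma dop_raises_fun a : series_raises a -> dop_raises (dop_fun _ a).
Proof.
by move=> ra i; rewrite /dop_coef coefC; case: eqP => // _; apply: series_raises0.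
Qed.

Lemma dop_raises_D : dop_raises (dop_D _).
Proof.
move=> i; rewrite /dop_coef coefX.
by case: eqP => _; [apply: series_raises1 | apply: series_raises0].
Qed.

Lemma dop_expand (P : Bethe_dop C N) :
  P = \sum_(i < size (dop_poly P)) dop_fun _ (dop_coef P i) * dop_D _ ^+ i.
Proof.
apply: dopP; apply/polyP => k.
transitivity (\sum_(i < size (dop_poly P)) dop_coef P i * (i == k :> nat)%:R).
  case: (ltnP k (size (dop_poly P))) => kP.
    rewrite (bigD1 (Ordinal kP)) //= eqxx mulr1 big1 ?addr0 // => i ik.
    by rewrite (_ : (i == k :> nat) = false) ?mulr0 //; apply: negbTE.
  rewrite nth_default // big1 // => i _.
  by rewrite ltn_eqF ?mulr0 // (leq_trans (ltn_ord i)).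
rewrite -[RHS]/(dop_coef _ k) (big_morph _ (dop_coefD k) (dop_coef0 _ k)).
by apply: eq_bigr => i _; rewrite dop_coef_funl dop_coef_Dexp.
Qed.

(** Moving D to the right differentiates coefficients, and d/du only shifts them to a higher power
    of u^-1. *)
Lemma dop_raisesM P Q : dop_raises P -> dop_raises Q -> dop_raises (P * Q).
Proof.
move=> dP dQ; rewrite [P]dop_expand mulr_suml; apply: dop_raises_sum => i.
rewrite -mulrA => k; rewrite dop_coef_funl; apply: series_raisesM; first exact: dP.
elim: (nat_of_ord i) k => [|j IHj] k; first by rewrite mul1r; apply: dQ.
rewrite exprS -mulrA dop_coef_Dl; apply: series_raisesD.
  by case: k => [|k]; [apply: series_raises0 | apply: IHj].
by apply: series_raises_der; apply: IHj.
Qed.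

Variable K : 'I_N -> C.

(** Every matrix entry satisfies [dop_raises], which is stable under the sums and products of the
    row determinant. *)
Lemma raises_Bethe_gen i l : raises l.-1 (Bethe_gen K i l).
Proof.
have rK j : series_raises (series_const (K j)%:A).
  case=> [|k]; last exact: raises0.
  by apply: raisesZ; apply: raises1.
have rN (P : Bethe_dop C N) : dop_raises P -> dop_raises (- P).
  by move=> rP k; rewrite /dop_coef coefN; apply: series_raisesN; apply: rP.
have rD (P Q : Bethe_dop C N) : dop_raises P -> dop_raises Q -> dop_raises (P + Q).
  by move=> rP rQ k; rewrite dop_coefD; apply: series_raisesD.
have r1 : dop_raises 1 := dop_raises_fun series_raises1.
suff : dop_raises (DB K) by apply.
apply: dop_raises_sum => s; apply: dop_raisesM.
  by case: odd_perm; rewrite ?expr0 ?expr1; [apply/rN |].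
elim/big_ind: _ => [||j _]; [exact: r1 | exact: dop_raisesM |].
rewrite mxE; apply/rD; last first.
  apply/rN; apply: dop_raises_fun; case=> [|r]; [exact: raises0 | exact: raises_gen].
case: eqP => _; last by move=> k; rewrite dop_coef0; apply: series_raises0.
by apply/rD; [apply: dop_raises_D | apply/rN; apply: dop_raises_fun; apply: rK].
Qed.
End TensorDegree.

(** * The first Bethe series and the power sums *)

Section LinearFactors.
Variables (S : nzRingType) (d : derivation S).
Implicit Types (Q : dop d) (b : S) (c : bool).

(** The shape of the entries of the matrix defining [DB], with [c] true exactly on the diagonal. *)
Definition linear_dop c b : dop d := (if c then dop_D d else 0) + dop_fun d b.

Lemma dop_coef_linearM c b Q k : dop_coef (linear_dop c b * Q) k =
  (if c then (if k is k'.+1 then dop_coef Q k' else 0) + d (dop_coef Q k) else 0)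
  + b * dop_coef Q k.
Proof.
rewrite mulrDl dop_coefD dop_coef_funl; congr (_ + _).
by case: c; rewrite ?dop_coef_Dl // mul0r dop_coef0.
Qed.

Variables (I : Type) (c : I -> bool) (b : I -> S).
Local Notation P r := (\prod_(i <- r) linear_dop (c i) (b i)).

Lemma dop_coef_linear_high (r : seq I) k : (count c r < k)%N -> dop_coef (P r) k = 0.
Proof.
elim: r k => [|i r IHr] k /= rk.
  by rewrite big_nil /dop_coef coef1; case: k rk.
rewrite big_cons dop_coef_linearM (IHr k) ?mulr0 ?addr0; last first.
  by rewrite (leq_ltn_trans _ rk) // leq_addl.
case: (c i) rk => //=; case: k => // k rk.
by rewrite IHr // ?der0 ?addr0.
Qed.

Lemma dop_coef_linear_top (r : seq I) : all c r -> dop_coef (P r) (size r) = 1.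
Proof.
elim: r => [|i r IHr] /=; first by rewrite big_nil /dop_coef coef1.
case/andP=> ci cr; rewrite big_cons dop_coef_linearM ci IHr //.
rewrite dop_coef_linear_high ?mulr0 ?der0 ?addr0 //.
by rewrite (eqP (etrans (esym (all_count c r)) cr)).
Qed.

(** The only derivative reaching this order is that of the leading coefficient 1. *)
Lemma dop_coef_linear_subtop (r : seq I) k : all c r -> size r = k.+1 ->
  dop_coef (P r) k = \sum_(i <- r) b i.
Proof.
elim: r k => [|i r IHr] k //= /andP[ci cr] [sr].
rewrite !big_cons dop_coef_linearM ci -sr dop_coef_linear_top // der1 addr0 mulr1 addrC.
congr (_ + _); case: r IHr cr sr => [|j r] IHr cr sr; first by rewrite /= big_nil.
by rewrite [LHS]/= (IHr (size r)).
Qed.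
End LinearFactors.

Section PowerSums.
Variables (C : comNzRingType) (N n : nat) (K : 'I_N.+1 -> C).

(** Whenever i is moved, so is [s i]; hence at least two of the N + 1 points are moved. *)
Lemma card_perm_fixed (s : 'S_N.+1) : s != 1%g -> (#|[pred i | i == s i]| < N)%N.
Proof.
move=> s1; have [i si] : exists i, s i != i.
  apply/existsP; apply: contraNT s1; rewrite negb_exists => /forallP s1.
  by apply/eqP/permP => i; rewrite perm1; apply/eqP; have := s1 i; rewrite negbK.
have ssi : s (s i) != s i by rewrite (inj_eq perm_inj).
have sub : [pred i | i == s i] \subset [predC [set i; s i]].
  apply/subsetP => j; rewrite !inE => /eqP sj; rewrite negb_or; apply/andP; split.
    by apply: contraNneq si => <-; rewrite -sj.
  by apply: contraNneq ssi => <-; rewrite -sj.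
rewrite (leq_ltn_trans (subset_leq_card sub)) //.
have := cardC [set i; s i]; rewrite cards2 eq_sym si card_ord => -[cN].
by rewrite -[X in (_ < X)%N]cN.
Qed.

(** The product of a nonidentity permutation has order below N, so the coefficient of D^N comes from
    the diagonal product alone. *)
Lemma Bethe_gen_trace r :
  Bethe_gen K ord0 r.+1 = - \sum_i U_gen (glt_tensor (delta_mx i i) r).
Proof.
pose b i j := - (if i == j then series_const (K i)%:A else 0)
  - U_current (delta_mx j i) : series (Uglt C N.+1).
have DBE : DB K = \sum_(s : 'S_N.+1) dop_fun _ ((-1) ^+ s) *
    \prod_i linear_dop (series_inv_ddu (Uglt C N.+1)) (i == s i) (b i (s i)).
  apply: eq_bigr => s _; congr (_ * _).
    by case: odd_perm; rewrite ?expr0 ?expr1; apply: dopP => //=; rewrite polyCN.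
  apply: eq_bigr => i _; rewrite mxE /linear_dop /b.
  apply: dopP; rewrite /= !polyCD !polyCN; case: eqP => _ /=.
    by rewrite addrA.
  by rewrite oppr0 !add0r.
rewrite /Bethe_gen DBE (big_morph _ (dop_coefD _) (dop_coef0 _ _)) /= subSS subn0.
rewrite (bigD1 (1%g : 'S_N.+1)) //= [X in _ + scoef X _]big1 => [|s s1]; last first.
  rewrite dop_coef_funl dop_coef_linear_high ?mulr0 //.
  rewrite (leq_trans _ (card_perm_fixed s1)) // cardE /enum_mem size_filter.
  by rewrite ltnS /index_enum -enumT.
rewrite [X in _ + X](_ : _ = 0) ?addr0 //.
rewrite odd_perm1 expr0 dop_coef_funl mul1r.
rewrite dop_coef_linear_subtop; last 2 first.
- by apply/allP => i _; rewrite perm1.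
- by rewrite /index_enum -enumT size_enum_ord.
rewrite series_sumE -sumrN; apply: eq_bigr => i _.
by rewrite /= perm1 eqxx /= oppr0 add0r.
Qed.

(** The e_ii add up to the identity matrix, whose tensor with t^r acts on factor s as z_s^r. *)
Lemma U_act_Bethe_gen_trace r (w : tensmod C N.+1 n) :
  U_act n (Bethe_gen K ord0 r.+1) w =
  [ffun a => - (\sum_s 'X_s ^+ r) * w a].
Proof.
transitivity (- \sum_i U_act n (U_gen (glt_tensor (delta_mx i i) r)) w).
  rewrite Bethe_gen_trace raddfN; congr (- _).
  by apply: (big_morph (fun x => U_act n x w)) => [x y|]; rewrite ?raddfD ?raddf0.
apply/ffunP => a; rewrite !ffunE sum_ffunE mulNr mulr_suml; congr (- _).
under eq_bigr do rewrite U_act_gen sum_ffunE.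
rewrite exchange_big; apply: eq_bigr => s _.
under eq_bigr do rewrite !ffunE; rewrite -mulr_sumr; congr (_ * _).
rewrite (bigD1 (a s)) //= (bigD1 (a s)) //= !mxE !eqxx mul1r.
rewrite big1 ?addr0 => [|j js]; last by rewrite !mxE eqxx (negPf js) mul0r.
rewrite big1 ?addr0 => [|i ia]; last first.
  by rewrite big1 // => j _; rewrite !mxE eq_sym (negPf ia) mul0r.
by congr (w _); apply/ffunP => k; rewrite ffunE; case: eqP => // ->.
Qed.
End PowerSums.

Lemma U_act_Bethe_gen_first (C : comNzRingType) N n (K : 'I_N -> C) (i : 'I_N) r
    (w : tensmod C N n) : i = 0%N :> nat ->
  U_act n (Bethe_gen K i r.+1) w = [ffun a => - (\sum_s 'X_s ^+ r) * w a].
Proof.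
case: N K i w => [|N] K i w i0; first by case: i i0.
by rewrite (_ : i = ord0) ?U_act_Bethe_gen_trace //; apply: val_inj.
Qed.

(** * Symmetric polynomials and algebraic dependence *)

Section Newton.
Variables (C : comNzRingType) (n : nat).
Local Notation A := {mpoly C[n]}.

Lemma coef_prod_mesym k :
  (\prod_(s < n) ('X_s *: 'X + 1 : {poly A}))`_k = mesym n C k.
Proof.
rewrite bigA_distr coef_sum (bigID (fun J : {set 'I_n} => #|J| == k)) /=.
have prodE (J : {set 'I_n}) :
    \prod_i (if i \in J then 'X_i *: 'X else 1) = (\prod_(i in J) 'X_i) *: 'X^#|J| :> {poly A}.
  by rewrite -big_mkcond /= scaler_prod prodr_const.
rewrite [X in _ + X]big1 ?addr0 => [|J Jk]; last first.
  by rewrite prodE coefZ coefXn eq_sym (negPf Jk) mulr0.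
by apply: eq_bigr => J /eqP <-; rewrite prodE coefZ coefXn eqxx mulr1.
Qed.

(** Coefficient of u^k in the logarithmic derivative of the product of the 1 + z_s u. *)
Lemma newton_identity k : mesym n C k.+1 *+ k.+1 =
  \sum_(j < k.+1) mesym n C j * ((-1) ^+ (k - j) * \sum_s 'X_s ^+ (k - j).+1).
Proof.
pose f : series A := \prod_(s < n) poly_series ('X_s *: 'X + 1).
(* The expansion of z_s / (1 + z_s u). *)
pose L s : series A := Series (fun i => (-1) ^+ i * 'X_s ^+ i.+1).
have fE i : f i = mesym n C i.
  by rewrite /f -rmorph_prod /= coef_prod_mesym.
have df : series_ddu A f = f * \sum_s L s.
  rewrite /f; elim/big_rec2: _ => [|s y x _ IH]; first by rewrite mulr0 der1.
  rewrite derM IH mulrDr mulrA; congr (_ + _).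
  rewrite [RHS]mulrAC; congr (_ * _); apply: seriesP => i.
  rewrite series_mulEl; case: i => [|i].
    rewrite big_ord1 /= !coefD !coefZ !coefX !coef1 /= expr0 expr1.
    by rewrite mulr0 add0r mul1r !mulr1 addr0 mul1r.
  rewrite big_ord_recl big_ord_recl big1 => [|j _]; last first.
    by rewrite /= coefD coefZ coefX coef1 /= mulr0 add0r mul0r.
  rewrite /= !coefD !coefZ !coefX !coef1 /= !mulr0 !add0r mul0rn mulr1 !addr0 mul1r.
  by rewrite /bump /= subn0 subSS subn0 [_ ^+ i.+1]exprS mulN1r mulNr [X in _ + X]mulrCA -exprS addNr.
have /(congr1 (fun g : series A => g k)) := df.
rewrite [RHS]series_mulEl /= fE => ->; apply: eq_bigr => j _.
by rewrite fE series_sumE /= -!mulr_sumr.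
Qed.
End Newton.

Lemma msizeX_le n (R : nzRingType) d (p : {mpoly R[n]}) k :
  (msize p <= d.+1)%N -> (msize (p ^+ k) <= (d * k).+1)%N.
Proof.
move=> pd; elim: k => [|k IHk]; first by rewrite expr0 msize1.
by rewrite exprS mulnS msizeM_leD.
Qed.

(** A dimension count: the products of powers of G and the H_i with exponents at most D outnumber
    the monomials that can occur in them. *)
Lemma algebraic_dependence (F : fieldType) n (G : {mpoly F[n]}) (H : n.-tuple {mpoly F[n]}) :
  exists2 Q : {poly {mpoly F[n]}}, Q != 0 & (map_poly (comp_mpoly H) Q).[G] = 0.
Proof.
pose c := (\max_(i < n) msize (tnth H i) + msize G).+1.
have Gc : (msize G <= c.+1)%N by do 2!apply: leqW; apply: leq_addl.
have Hc i : (msize (tnth H i) <= c.+1)%N.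
  do 2!apply: leqW; rewrite (leq_trans _ (leq_addr _ _)) //.
  exact: (leq_bigmax (F := fun i => msize (tnth H i)) i).
(* The products have degree at most E = c' D, so at most (E + 1)^n monomials occur. This is at most
   c'^n (D + 1)^n, and the choice D = c'^n makes it smaller than (D + 1)^(n+1). *)
pose c' := (n.+1 * c)%N; pose D := (c' ^ n)%N; pose E := (c' * D)%N.
pose T := ('I_D.+1 * {ffun 'I_n -> 'I_D.+1})%type.
pose M := {ffun 'I_n -> 'I_E.+1}.
pose y (t : T) := G ^+ t.1 * \prod_(i < n) tnth H i ^+ t.2 i.
have yE t : (msize (y t) <= E.+1)%N.
  have prod_le : (msize (\prod_(i < n) tnth H i ^+ t.2 i)%R <= (\sum_(i < n) c * D).+1)%N.
    elim/big_rec2: _ => [|i x z _ IH]; first by rewrite msize1.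
    rewrite msizeM_leD // (leq_trans (msizeX_le _ (Hc i))) // ltnS leq_mul2l.
    by rewrite -ltnS ltn_ord orbT.
  rewrite /E /c' mulSn mulnDl -mulnA.
  rewrite sum_nat_const card_ord in prod_le; apply: msizeM_leD prod_le.
  by rewrite (leq_trans (msizeX_le _ Gc)) // ltnS leq_mul2l -ltnS ltn_ord orbT.
have ltMT : (#|{: M}| < #|{: T}|)%N.
  rewrite card_prod !card_ffun !card_ord.
  have EcD : (E.+1 <= c' * D.+1)%N by rewrite mulnS addnC -addn1 leq_add2l.
  have EcDn : (E.+1 ^ n <= (c' * D.+1) ^ n)%N.
    by case: (n) => // k; rewrite leq_exp2r.
  rewrite (leq_ltn_trans EcDn) //.
  by rewrite expnMn ltn_mul2r expn_gt0 ltnSn.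
pose B : 'M[F]_(#|{: T}|, #|{: M}|) :=
  \matrix_(t, m) (y (enum_val t))@_[multinom ((enum_val m : M) i : nat) | i < n].
have [u u0 uB] : exists2 u : 'rV_#|{: T}|, u != 0 & u *m B = 0.
  have kB : kermx B != 0.
    by rewrite -mxrank_eq0 mxrank_ker -lt0n subn_gt0 (leq_ltn_trans (rank_leq_col B)).
  exists (nz_row (kermx B)); first by rewrite nz_row_eq0.
  by apply/sub_kermxP; apply: nz_row_sub.
have uy : \sum_t u 0 (enum_rank t) *: y t = 0.
  apply/mpolyP => m; rewrite mcoeff0 raddf_sum /=.
  case: (leqP (mdeg m) E) => mE; last first.
    rewrite big1 // => t _; rewrite mcoeffZ memN_msupp_eq0 ?mulr0 //.
    by apply: msize_mdeg_ge; apply: leq_trans (yE t) mE.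
  have mi i : (m i < E.+1)%N.
    by rewrite ltnS (leq_trans _ mE) // mdegE (bigD1 i) //= leq_addr.
  have := congr1 (fun A : 'rV[F]_#|{: M}| => A 0 (enum_rank ([ffun i => Ordinal (mi i)] : M))) uB.
  rewrite !mxE (reindex (enum_rank : T -> _)) /=; last exact/onW_bij/enum_rank_bij.
  move=> uB0; rewrite -[RHS]uB0; apply: eq_bigr => t _.
  rewrite mcoeffZ !mxE !enum_rankK; congr (_ * _@__).
  by apply/mnmP => i; rewrite mnmE ffunE.
pose bm (t : T) := [multinom (t.2 i : nat) | i < n].
(* The linear relation among the products is read as a polynomial; distinct t give distinct
   monomials, so it is nonzero. *)
exists (\sum_t (u 0 (enum_rank t) *: 'X_[bm t]) *: 'X^(t.1)); last first.
  rewrite raddf_sum horner_sum -[RHS]uy; apply: eq_bigr => t _ /=.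
  rewrite map_polyZ map_polyXn hornerZ hornerXn /= comp_mpolyZ comp_mpolyX.
  rewrite -scalerAl mulrC; congr (_ *: (_ * _)).
  by apply: eq_bigr => i _; rewrite mnmE.
have [t ut] : exists t, u 0 (enum_rank t) != 0.
  have /rV0Pn[k uk] := u0; exists (enum_val k); by rewrite enum_valK.
apply: contraNneq ut => /(congr1 (fun q : {poly {mpoly F[n]}} => (q`_t.1)@_(bm t))).
rewrite coef0 mcoeff0 coef_sum raddf_sum (bigD1 t) //= coefZ coefXn eqxx mulr1.
rewrite mcoeffZ mcoeffX eqxx mulr1 big1 ?addr0 => [->//|t' t't].
rewrite coefZ coefXn; case: eqP => tt1; last by rewrite mulr0 mcoeff0.
rewrite mulr1 mcoeffZ mcoeffX; case: eqP => tt2; last by rewrite mulr0.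
case/eqP: t't; case: t t' tt1 tt2 => a b [a' b'] /= /val_inj -> /mnmP bb.
by congr (_, _); apply/ffunP => i; have := bb i; rewrite !mnmE => /val_inj.
Qed.

(** * Invariant vectors of a given weight *)

Lemma telescope_sumn_decr (f : nat -> nat) a b : (forall k, f k.+1 <= f k)%N ->
  (a <= b)%N -> (\sum_(a <= k < b) (f k - f k.+1) = f a - f b)%N.
Proof.
move=> fS; elim: b => [|b IHb]; first by rewrite leqn0 => /eqP->; rewrite big_geq ?subnn.
rewrite leq_eqVlt => /orP[/eqP->|ab]; first by rewrite big_geq ?subnn.
have fb : (f b <= f a)%N.
  elim: b {IHb} ab => [|b IHb]; first by rewrite ltnS leqn0 => /eqP->.
  by rewrite ltnS leq_eqVlt => /orP[/eqP->//|ab]; apply: leq_trans (fS b) (IHb ab).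
by rewrite big_nat_recr //= IHb // addnBA // subnK.
Qed.

Section WeightSpace.
Variables (C : numFieldType) (N : nat) (lam : 'I_N -> nat).
Local Notation n := #|{: Oidx lam}|.

(** Tensor factors and variables z are labelled by the same pairs (i, j) as the generators f_ij,
    block i having lam_i positions. *)
Definition rk (i : 'I_N) (j : 'I_(lam i)) : 'I_n :=
  enum_rank (Tagged (fun i => 'I_(lam i)) j : Oidx lam).

Lemma rkP (P : 'I_n -> Prop) : (forall i (j : 'I_(lam i)), P (rk j)) -> forall k, P k.
Proof.
move=> Prk k; rewrite -[k]enum_valK.
by case: (enum_val k) => i j; apply: Prk.
Qed.

Lemma sum_rk (f : 'I_n -> nat) : (\sum_k f k = \sum_i \sum_(j < lam i) f (rk j))%N.
Proof.
rewrite sig_big_dep /= (reindex (enum_rank : Oidx lam -> _)) /=.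
  by apply: eq_bigr => -[i j].
exact/onW_bij/enum_rank_bij.
Qed.

Definition Oweight (m : 'X_{1..n}) : nat := (\sum_k (m k * (tagged (enum_val k)).+1))%N.

(* Monomials of O_lam index the orbits of S_lam on monomials in the z's: the
   exponents of z in each block form a partition, and f_ij counts the columns
   of length j of its diagram *)
Definition conj_mnm (m : 'X_{1..n}) : 'X_{1..n} :=
  [multinom (let p := enum_val k in
     \sum_(j < lam (tag p) | tagged p <= j) m (rk j))%N | k < n].

Lemma conj_mnmE m i (j : 'I_(lam i)) :
  conj_mnm m (rk j) = (\sum_(j' < lam i | j <= j') m (rk j'))%N.
Proof. by rewrite mnmE enum_rankK. Qed.

(** The exponent of the variable at position j enters the j + 1 positions up to j, and j + 1 is its
    degree. *)
Lemma mdeg_conj_mnm m : mdeg (conj_mnm m) = Oweight m.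
Proof.
rewrite mdegE /Oweight !sum_rk; apply: eq_bigr => i _.
under eq_bigr do rewrite conj_mnmE.
rewrite (exchange_big_dep xpredT) //=; apply: eq_bigr => j _.
rewrite enum_rankK /= (eq_bigl (fun j0 : 'I_(lam i) => (j0 < j.+1)%N)) //.
by rewrite -(big_ord_widen _ (fun=> m (rk j))) // sum_nat_const card_ord mulnC.
Qed.

(** The preimage consists of the successive differences of exponents within each block. *)
Lemma conj_mnm_sorted (z : 'X_{1..n}) :
  (forall i (j j' : 'I_(lam i)), (j < j')%N -> (z (rk j') <= z (rk j))%N) ->
  exists m, conj_mnm m = z.
Proof.
(* Extension by zero past the block makes the last difference equal to the last exponent. *)
move=> zs; pose zz i j := if insub j is Some o then z (rk (o : 'I_(lam i))) else 0%N.
have zzE i (j : 'I_(lam i)) : zz i j = z (rk j) by rewrite /zz valK.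
have zz0 i j : (lam i <= j)%N -> zz i j = 0%N by move=> ij; rewrite /zz insubF // ltnNge ij.
have zzS i j : (zz i j.+1 <= zz i j)%N.
  case: (ltnP j.+1 (lam i)) => ij; last by rewrite (zz0 _ j.+1).
  by have := zs i (Ordinal (ltnW ij)) (Ordinal ij) (leqnn _); rewrite -!zzE.
exists [multinom (let p := enum_val k in zz (tag p) (tagged p) - zz (tag p) (tagged p).+1)%N
        | k < n].
apply/mnmP; apply: rkP => i j; rewrite conj_mnmE -zzE.
under eq_bigr do rewrite mnmE enum_rankK /=.
transitivity (\sum_(j <= j' < lam i) (zz i j' - zz i j'.+1))%N.
  by rewrite big_geq_mkord.
by rewrite (telescope_sumn_decr (zzS i)) ?(ltnW (ltn_ord j)) // (zz0 i (lam i)) ?subn0.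
Qed.

(** The index of the basis tensor with e_i at every position of block i; its stabilizer is the Young
    subgroup. *)
Definition block_of : {ffun 'I_n -> 'I_N} := [ffun k => tag (enum_val k)].

Lemma block_of_rk i (j : 'I_(lam i)) : block_of (rk j) = i.
Proof. by rewrite ffunE enum_rankK. Qed.

Lemma card_block i : #|[pred k | block_of k == i]| = lam i.
Proof.
rewrite -sum1_card big_mkcond sum_rk (bigD1 i) //= [X in (_ + X)%N]big1 => [|i' ii'].
  rewrite addn0; transitivity #|'I_(lam i)|; last exact: card_ord.
  by rewrite -[RHS]sum1_card; apply: eq_bigr => j _; rewrite inE block_of_rk eqxx.
by rewrite big1 // => j _; rewrite inE block_of_rk (negPf ii').
Qed.

Variable w : tensmod C N n.
Hypothesis w_inv : w \in inv_weight lam.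

Lemma perm_act_inv s a : w a = msym s (w [ffun k => a (s k)]).
Proof.
have /andP[/forallP/(_ s)/eqP sw _] := w_inv.
by rewrite -{1}sw ffunE.
Qed.

(** The element e_ii scales the coordinate at [a] by the number of positions where [a] takes the
    value i. *)
Lemma weight_coord a i : w a != 0 -> #|[pred k | a k == i]| = lam i.
Proof.
move=> wa0; have /andP[_ /forallP/(_ i)/eqP ww] := w_inv.
have := congr1 (fun w : tensmod C N n => w a) ww.
rewrite /= glt_act_tensor sum_ffunE [RHS]ffunE.
have -> : \sum_s [ffun a0 : {ffun 'I_n -> 'I_N} => 'X_s ^+ 0 *
    factor_act s (map_mx (@mpolyC n C) (delta_mx i i)) w a0] a =
    #|[pred k | a k == i]|%:R *: w a.
  rewrite -(sum1_card [pred k | a k == i]) natr_sum scaler_suml [RHS]big_mkcond; apply: eq_bigr => s _.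
  rewrite !ffunE expr0 mul1r (bigD1 (a s)) //= big1 ?addr0 => [|j js].
    rewrite !mxE inE (_ : subst_at a s (a s) = a); last first.
      by apply/ffunP => k; rewrite ffunE; case: eqP => // ->.
    by case: eqP => _; rewrite /= ?mpolyC1 ?mpolyC0 ?mul1r ?mul0r ?scale1r.
  rewrite !mxE; case: (eqVneq (a s) i) js => [->|_] js;
    by rewrite ?(negPf js) mpolyC0 mul0r.
move=> /eqP; rewrite -subr_eq0 -scalerBl scaler_eq0 (negPf wa0) orbF subr_eq0 eqr_nat.
by move/eqP.
Qed.

(** An index of a nonzero coordinate has the same content as [block_of], so a permutation carries
    one to the other and invariance relates the coordinates. *)
Lemma inv_coord0 : w block_of = 0 -> w = 0.
Proof.
move=> w0; apply/ffunP => a; rewrite ffunE; apply/eqP/negPn/negP => wa.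
have : perm_eq [tuple block_of k | k < n] [tuple a k | k < n].
  apply/allP => i _ /=; apply/eqP; rewrite !count_map.
  have cE (b : {ffun 'I_n -> 'I_N}) : count (preim b (pred1 i)) (Finite.enum 'I_n) = #|[pred k | b k == i]|.
    by rewrite (cardE [pred k | b k == i]) size_filter; apply: eq_count.
  transitivity (lam i); first exact: etrans (cE block_of) (card_block i).
  by apply/esym; apply: etrans (cE a) (weight_coord i wa).
case/tuple_permP => s sE; case/eqP: wa; rewrite (perm_act_inv s).
rewrite (_ : [ffun k => a (s k)] = block_of) ?w0 ?rmorph0 //.
apply/ffunP => k; have := congr1 (fun t => nth (a k) t k) sE.
by rewrite -!tnth_nth !tnth_mktuple => bk; rewrite ffunE -bk.
Qed.

(** A support monomial maximizing [pot] is sorted: swapping two positions of a block preserves the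
    support, and swapping a misplaced pair would increase [pot]. *)
Lemma exists_sorted_support : w block_of != 0 ->
  exists m, conj_mnm m \in msupp (w block_of).
Proof.
move=> q0; set q := w block_of in q0 *.
(* These weights decrease strictly along each block. *)
pose c (k : 'I_n) := (lam (tag (enum_val k)) - tagged (enum_val k))%N.
pose pot (z : 'X_{1..n}) := (\sum_k z k * c k)%N.
pose attained p := has (fun z => pot z == p) (msupp q).
have [z0 z0q] : exists z, z \in msupp q.
  by exists (mlead q); apply: mlead_supp.
have ex : exists p, attained p by exists (pot z0); apply/hasP; exists z0.
have bnd p : attained p -> (p <= \max_(z <- msupp q) pot z)%N.
  by case/hasP => z zq /eqP <-; apply: leq_bigmax_seq.
case: (ex_maxnP ex bnd) => p /hasP[z zq /eqP zp] pmax.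
have zs i (j j' : 'I_(lam i)) : (j < j')%N -> (z (rk j') <= z (rk j))%N.
  move=> jj'; rewrite leqNgt; apply/negP => zlt.
  pose t := tperm (rk j) (rk j').
  have tq : msym t q = q.
    rewrite [RHS](perm_act_inv t block_of); congr (msym t (w _)).
    by apply/ffunP => k; rewrite [RHS]ffunE /t; case: tpermP => [->|->|//]; rewrite !block_of_rk.
  pose zt := [multinom z (t k) | k < n].
  have ztq : zt \in msupp q.
    by move: zq; rewrite !mcoeff_msupp -{1}tq mcoeff_sym.
  have := pmax (pot zt); rewrite leqNgt => /(_ _)/negP[].
    by apply/hasP; exists zt.
  have rkjj' : rk j' != rk j.
    rewrite (inj_eq enum_rank_inj) -tag_eqE /tag_eq eqxx /= tagged_asE.
    by rewrite -val_eqE /= gtn_eqF.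
  rewrite -zp /pot (bigD1 (rk j)) //= (bigD1 (rk j')) //=.
  rewrite [X in (_ < X)%N](bigD1 (rk j)) //= [X in (_ < _ + X)%N](bigD1 (rk j')) //=.
  rewrite !mnmE tpermL tpermR !addnA.
  under [X in (_ < _ + X)%N]eq_bigr => k /andP[kj kj'] do
    rewrite mnmE tpermD 1?eq_sym //.
  rewrite ltn_add2r /c !enum_rankK /=.
  have := ltn_ord j'; move: zlt jj'; move: (z (rk j)) (z (rk j')) => x y xy jj' j'l.
  have -> : (lam i - j = (lam i - j') + (j' - j))%N by rewrite addnBA ?subnK // ltnW.
  rewrite !mulnDr addnAC [X in (_ < X)%N]addnC [X in (_ < X)%N]addnA ltn_add2l.
  by rewrite ltn_mul2r subn_gt0 jj'.
have [m mz] := conj_mnm_sorted zs.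
by exists m; rewrite mz.
Qed.

(** This bounds the dimension of the piece of degree at most d by the number of monomials of O_lam
    of degree at most d. *)
Lemma inv_weight_coef0 d : tens_le d w ->
  (forall m, (Oweight m <= d)%N -> (w block_of)@_(conj_mnm m) = 0) -> w = 0.
Proof.
move=> wd cw; apply: inv_coord0; apply/eqP/negPn/negP => /exists_sorted_support[m ms].
move: (ms); rewrite mcoeff_msupp cw ?eqxx // -mdeg_conj_mnm -ltnS.
exact: leq_trans (msize_mdeg_lt ms) (wd _).
Qed.
End WeightSpace.

(** * The isomorphism *)

Section Main.
Variables (C : numFieldType) (N : nat) (K : 'I_N -> C) (lam : 'I_N -> nat).
Hypothesis K_inj : injective K.
Local Notation A := (Olam C lam).
Local Notation n := #|{: Oidx lam}|.
Variable F : 'I_N -> nat -> A.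
Hypothesis F_coefs : DO_coefs K F.
Variable tau : {lrmorphism A -> lend (Mlam C n lam)}.
Hypothesis tau_F : forall i j, restricts_to (Bethe_gen K i j) (tau (F i j)).
Implicit Types (G H : A) (m w : Mlam C n lam).

Let MvalD m w : Mval (m + w) = Mval m + Mval w. Proof. by []. Qed.
Let MvalZ c m : Mval (c *: m) = c *: Mval m. Proof. by []. Qed.

Let Mval0 a : Mval (0 : Mlam C n lam) a = 0. Proof. exact: ffunE. Qed.

Lemma tauD G H m : tau (G + H) m = tau G m + tau H m.
Proof. by rewrite raddfD. Qed.
Lemma tauZ c G m : tau (c *: G) m = c *: tau G m.
Proof. by rewrite linearZ. Qed.
Lemma tauM G H m : tau (G * H) m = tau G (tau H m).
Proof. by rewrite rmorphM. Qed.
Lemma tau1 m : tau 1 m = m.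
Proof. by rewrite rmorph1. Qed.
Lemma tau0 m : tau 0 m = 0.
Proof. by rewrite raddf0. Qed.

Definition tau_raises d G :=
  forall e m, tens_le e (Mval m) -> tens_le (e + d) (Mval (tau G m)).

Lemma tau_raisesW d e G : (d <= e)%N -> tau_raises d G -> tau_raises e G.
Proof. by move=> de dG f m fm; apply: tens_leW (dG _ _ fm); rewrite leq_add2l. Qed.

Lemma tau_raisesD d G H : tau_raises d G -> tau_raises d H -> tau_raises d (G + H).
Proof. by move=> dG dH e m em; rewrite tauD MvalD; apply: tens_leD; [apply: dG | apply: dH]. Qed.

Lemma tau_raisesM d e G H : tau_raises d G -> tau_raises e H -> tau_raises (d + e) (G * H).
Proof.
move=> dG eH f m fm; rewrite tauM [(d + e)%N]addnC addnA.
by apply: dG; apply: eH.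
Qed.

Lemma tau_raisesC c : tau_raises 0 c%:MP.
Proof.
move=> e m em; rewrite -[c%:MP]mulr1 mul_mpolyC tauZ tau1 MvalZ addn0.
exact: tens_leZ.
Qed.

Lemma tau_raises_F i l : tau_raises l.-1 (F i l).
Proof. by move=> e m em; rewrite tau_F; apply: raises_Bethe_gen. Qed.

(** [tau_raises] satisfies the axioms of the abstract filtration [fil]. *)
Lemma tau_raises_var i (j : 'I_(lam i)) : tau_raises j.+1 (Ovar C j).
Proof.
have := fcoef_fil K_inj F_coefs tau_raisesW tau_raisesD tau_raisesM tau_raisesC
  tau_raises_F (ltn_ord j).
by rewrite /fcoef valK.
Qed.

Lemma tau_raises_monomial z : tau_raises (Oweight z) 'X_[z].
Proof.
rewrite mpolyXE_id /Oweight; elim/big_rec2: _ => [|k G d _ dG].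
  by rewrite -(mpolyC1 _ C); apply: tau_raisesC.
apply: tau_raisesM dG; elim: (z k) => [|e IHe].
  by rewrite mul0n expr0 -(mpolyC1 _ C); apply: tau_raisesC.
rewrite exprS mulSn; apply: tau_raisesM IHe.
move: k; apply: rkP => i j; rewrite enum_rankK; exact: tau_raises_var.
Qed.

Lemma tau_raises_Odeg d G : (Odeg G <= d)%N -> tau_raises d G.
Proof.
move/bigmax_leqP_seq => Gd; rewrite [G]mpolyE big_seq.
elim/big_ind: _ => [||z zG]; [| exact: tau_raisesD |].
  by rewrite -(mpolyC0 _ C); apply: (tau_raisesW (leq0n d)); apply: tau_raisesC.
rewrite -mul_mpolyC -[d]add0n; apply: tau_raisesM; first exact: tau_raisesC.
by apply: tau_raisesW (tau_raises_monomial z); apply: Gd.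
Qed.

Definition acts_by H (q : {mpoly C[n]}) := forall m a, Mval (tau H m) a = q * Mval m a.

Lemma acts_by1 : acts_by 1 1.
Proof. by move=> m a; rewrite tau1 mul1r. Qed.

Lemma acts_by0 : acts_by 0 0.
Proof. by move=> m a; rewrite tau0 mul0r ffunE. Qed.

Lemma acts_byD G H q r : acts_by G q -> acts_by H r -> acts_by (G + H) (q + r).
Proof. by move=> Gq Hr m a; rewrite tauD MvalD ffunE Gq Hr mulrDl. Qed.

Lemma acts_byM G H q r : acts_by G q -> acts_by H r -> acts_by (G * H) (q * r).
Proof. by move=> Gq Hr m a; rewrite tauM Gq Hr mulrA. Qed.

Lemma acts_byZ c H q : acts_by H q -> acts_by (c *: H) (c *: q).
Proof. by move=> Hq m a; rewrite tauZ MvalZ ffunE Hq scalerAl. Qed.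

(** Up to sign F_(1,r+1) acts as the r-th power sum, and Newton's identities can be divided by k +
    1. A tensor factor exists by 0 < n, which provides the row [i0]. *)
Lemma acts_by_mesym k : (0 < n)%N -> exists H, acts_by H (mesym n C k).
Proof.
move=> n0; have [i0 i00] : exists i : 'I_N, i = 0%N :> nat.
  case: (enum_val (Ordinal n0)) => i _.
  by exists (Ordinal (leq_ltn_trans (leq0n i) (ltn_ord i))).
have psum r : acts_by (- F i0 r.+1) (\sum_s 'X_s ^+ r).
  move=> m a; rewrite -scaleN1r tauZ MvalZ ffunE tau_F U_act_Bethe_gen_first //.
  by rewrite ffunE scaleN1r mulNr opprK.
elim/ltn_ind: k => -[_|k IHk]; first by exists 1; rewrite mesym0E; apply: acts_by1.
suff [H HE] : exists H, acts_by H (mesym n C k.+1 *+ k.+1).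
  exists (k.+1%:R^-1 *: H).
  rewrite (_ : mesym n C k.+1 = k.+1%:R^-1 *: (mesym n C k.+1 *+ k.+1)).
    exact: acts_byZ.
  by rewrite -scaler_nat scalerA mulVf ?scale1r // pnatr_eq0.
rewrite newton_identity.
elim/big_ind: _ => [|q r [G GE] [H HE]|j _]; first by exists 0; apply: acts_by0.
  by exists (G + H); apply: acts_byD.
have [H HE] := IHk j (ltn_ord j).
exists (H * ((-1) ^+ (k - j) *: - F i0 (k - j).+2)).
apply: acts_byM => //.
rewrite (_ : (-1) ^+ (k - j) = ((-1) ^+ (k - j))%:MP); last by rewrite rmorphXn rmorphN1.
by rewrite mul_mpolyC; apply: acts_byZ.
Qed.

Lemma acts_by_comp (H : n.-tuple A) (e : n.-tuple {mpoly C[n]}) (q : {mpoly C[n]}) :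
  (forall i, acts_by (tnth H i) (tnth e i)) -> acts_by (q \mPo H) (q \mPo e).
Proof.
move=> He; elim/mpolyind: q => [|c z q _ _ IHq]; first by rewrite !raddf0; apply: acts_by0.
rewrite !comp_mpolyD !comp_mpolyZ !comp_mpolyX; apply: acts_byD IHq; apply: acts_byZ.
elim/big_rec2: _ => [|i G r _ rG]; first exact: acts_by1.
apply: acts_byM rG; elim: (z i) => [|l IHl]; first by rewrite !expr0; apply: acts_by1.
by rewrite !exprS; apply: acts_byM.
Qed.

(* The kernel of G |-> tau G v is an ideal, and it cannot contain an element
   acting as the multiplication by a nonzero symmetric polynomial *)
Lemma tau_eq0 G w : w != 0 -> tau G w = 0 -> G = 0.
Proof.
move=> w0 Gw; apply/eqP/negPn/negP => G0.
have exH (i : 'I_n) : exists H, acts_by H (mesym n C i.+1).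
  by apply: acts_by_mesym; apply: leq_trans (ltn_ord i).
have [H HE] := fin_all_exists exH.
pose Ht := [tuple H i | i < n]; pose S := [tuple mesym n C i.+1 | i < n].
have [Q Q0 QG] := algebraic_dependence G Ht.
(* A relation without constant term can be divided by the nonzero G. Once the constant term c is
   nonzero, the relation shows that c evaluated at the H_i is a multiple of G. *)
have [c c0 [R cR]] : exists2 c, c != 0 & exists R, c \mPo Ht = R * G.
  elim/poly_ind: Q Q0 QG => [|P c IHP]; first by rewrite eqxx.
  rewrite rmorphD rmorphM /= map_polyX map_polyC hornerD hornerMX hornerC /=.
  have [->|c0] := eqVneq c 0.
    rewrite addr0 comp_mpoly0 addr0 => PX /eqP; rewrite mulf_eq0 (negPf G0) orbF => /eqP PG.
    by apply: IHP PG; apply: contraNneq PX => ->; rewrite mul0r.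
  move=> _ PGc; exists c => //; exists (- (map_poly (comp_mpoly Ht) P).[G]).
  by apply/eqP; rewrite mulNr -addr_eq0 addrC PGc.
have cS : acts_by (c \mPo Ht) (c \mPo S).
  by apply: acts_by_comp => i; rewrite !tnth_mktuple.
(* The elementary symmetric polynomials are algebraically independent. *)
have cS0 : c \mPo S != 0.
  by apply: contraNneq c0 => /msym_fundamental_un0 ->.
case/eqP: w0; apply/val_inj/ffunP => a; apply: etrans (esym (Mval0 a)).
have := cS w a; rewrite cR tauM Gw linear0 Mval0 => /esym/eqP.
by rewrite mulf_eq0 (negPf cS0) => /eqP.
Qed.

(** * The map given by the vector of degree zero *)

Variable v : Mlam C n lam.
Hypotheses (v_neq0 : v != 0) (v_deg0 : tens_deg (Mval v) = 0%N).

Lemma tau_inj_v : injective (fun G => tau G v).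
Proof.
move=> G H GH; apply/eqP; rewrite -subr_eq0 -scaleN1r; apply/eqP.
by apply: (tau_eq0 v_neq0); rewrite tauD tauZ scaleN1r GH subrr.
Qed.

Lemma tau_deg_le d G : (Odeg G <= d)%N -> tens_le d (Mval (tau G v)).
Proof.
move=> Gd; apply: (tau_raises_Odeg Gd (e := 0)).
by apply/tens_degP; rewrite v_deg0.
Qed.

Lemma Oweight_bounded d : exists s : seq 'X_{1..n},
  uniq s /\ forall z, (z \in s) = (Oweight z <= d)%N.
Proof.
pose g (f : {ffun 'I_n -> 'I_d.+1}) := [multinom (f i : nat) | i < n].
exists (undup [seq z <- [seq g f | f : {ffun 'I_n -> 'I_d.+1}] | (Oweight z <= d)%N]).
split=> [|z]; first exact: undup_uniq.
rewrite mem_undup mem_filter andb_idr // => zd.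
have zi i : (z i < d.+1)%N.
  rewrite ltnS (leq_trans _ zd) // /Oweight (bigD1 i) //=.
  by rewrite mulnS -addnA leq_addr.
apply/imageP; exists [ffun i => Ordinal (zi i)] => //.
by apply/mnmP => i; rewrite mnmE ffunE.
Qed.

(* The filtered pieces of O_lam and M_lam have the same dimension *)
Lemma tau_surj_le d w : tens_le d (Mval w) -> exists2 G, (Odeg G <= d)%N & tau G v = w.
Proof.
move=> wd; have [s [us sE]] := Oweight_bounded d.
pose p := size s; pose x (i : 'I_p) := tnth (in_tuple s) i.
have x_inj : injective x by apply/(tuple_uniqP (in_tuple s)).
(* By [inv_weight_coef0], these coefficients determine a vector of degree at most d. *)
pose co w : 'rV[C]_p := \row_j (Mval w (block_of lam))@_(conj_mnm (x j)).
pose g (u : 'rV[C]_p) : A := \sum_i u 0 i *: 'X_[x i].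
have xd i : (Oweight (x i) <= d)%N by rewrite -sE mem_tnth.
have gd u : (Odeg (g u) <= d)%N.
  apply/bigmax_leqP_seq => z zg _; rewrite -[X in (X <= _)%N]/(Oweight z) -sE.
  move: zg; rewrite mcoeff_msupp raddf_sum /=; apply: contraNT => zs.
  rewrite big1 // => i _; rewrite mcoeffZ mcoeffX; case: eqP => [xz|]; rewrite ?mulr0 //.
  by rewrite -xz mem_tnth in zs.
have co_inj w' : tens_le d (Mval w') -> co w' = 0 -> w' = 0.
  move=> w'd cw'; apply: val_inj; apply: (inv_weight_coef0 (valP w') w'd) => z.
  rewrite -sE => zs; have [i ->] := tnthP (in_tuple s) z zs.
  by have := congr1 (fun u : 'rV_p => u 0 i) cw'; rewrite !mxE.
have coD w1 w2 : co (w1 + w2) = co w1 + co w2.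
  by apply/rowP => j; rewrite !mxE MvalD ffunE mcoeffD.
have coZ c w1 : co (c *: w1) = c *: co w1.
  by apply/rowP => j; rewrite !mxE MvalZ ffunE mcoeffZ.
pose B := \matrix_i co (tau 'X_[x i] v).
have coB u : co (tau (g u) v) = u *m B.
  rewrite mulmx_sum_row /g (big_morph (tau^~ v) (fun G H => tauD G H v) (tau0 v)).
  have co0 : co 0 = 0 by rewrite -(scale0r 0) coZ scale0r.
  rewrite (big_morph co coD co0); apply: eq_bigr => i _.
  by rewrite tauZ coZ rowK.
(* [B] is square, since the same list [s] indexes the monomials of O_lam and the coefficients read
   by [co]; injectivity makes its rows independent. *)
have Bu : B \in unitmx.
  rewrite -row_free_unit; apply: inj_row_free => u uB.
  have gu0 : g u = 0.
    by apply: (tau_eq0 v_neq0); apply: co_inj; [exact: tau_deg_le | rewrite coB].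
  apply/rowP => i; rewrite mxE.
  have := congr1 (mcoeff (x i)) gu0; rewrite mcoeff0 raddf_sum /= (bigD1 i) //=.
  rewrite mcoeffZ mcoeffX eqxx mulr1 big1 ?addr0 // => j ji.
  rewrite mcoeffZ mcoeffX (_ : (x j == x i) = false) ?mulr0 //.
  by apply/negbTE; apply: contraNneq ji => /x_inj ->.
exists (g (co w *m invmx B)); first exact: gd.
apply/eqP; rewrite -subr_eq0 -scaleN1r; apply/eqP; apply: co_inj.
  rewrite MvalD MvalZ; apply: tens_leD; last exact: tens_leZ.
  exact: tau_deg_le.
by rewrite coD coZ coB mulmxKV // scaleN1r subrr.
Qed.

Lemma tau_bij_v : bijective (fun G => tau G v).
Proof.
have surj w : exists G, tau G v == w.
  have [|G _ <-] := @tau_surj_le (tens_deg (Mval w)) w; first exact/tens_degP.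
  by exists G.
exists (fun w => xchoose (surj w)) => [G | w]; last exact/eqP/(xchooseP (surj w)).
by apply: tau_inj_v; apply/eqP/(xchooseP (surj (tau G v))).
Qed.

(** For the lower bound, filtered surjectivity gives a preimage of [tau G v] of degree at most that
    of [tau G v], and injectivity identifies it with G. *)
Lemma tens_deg_tau G : tens_deg (Mval (tau G v)) = Odeg G.
Proof.
apply/eqP; rewrite eqn_leq; apply/andP; split; first exact/tens_degP/tau_deg_le.
have [|H + /tau_inj_v HG] := @tau_surj_le (tens_deg (Mval (tau G v))) (tau G v).
  exact/tens_degP.
by rewrite HG.
Qed.
End Main.

Theorem theorem6p7 (R : realType) (N n : nat) (K : 'I_N -> R[i])
    (lam : 'I_N -> nat)
    (K_distinct : injective K) (lam_partition : is_partition n lam)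
    (F : 'I_N -> nat -> Olam R[i] lam) (F_coefs : DO_coefs K F)
    (tau : {lrmorphism Olam R[i] lam -> lend (Mlam R[i] n lam)})
    (tau_inj : injective tau)
    (tau_image : forall T, Bethe_image K T <-> exists G, tau G = T)
    (tau_F : forall i j, restricts_to (Bethe_gen K i j) (tau (F i j)))
    (v : Mlam R[i] n lam) (v_neq0 : v != 0) (v_deg0 : tens_deg (Mval v) = 0%N) :
  let mu := fun G : Olam R[i] lam => tau G v in
  [/\ linear mu, bijective mu,
      forall G, G != 0 -> tens_deg (Mval (mu G)) = Odeg G &
      forall G H, mu (G * H) = tau G (mu H)].
Proof.
move=> mu.
(* Substituting the number of pairs (i, j) for n lets these pairs label the tensor factors. *)
have nE : #|{: Oidx lam}| = n.
  rewrite -lam_partition.2 -sum1_card (eq_bigr (fun i => \sum_(j < lam i) 1)%N).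
    by rewrite sig_big_dep.
  by move=> i _; rewrite sum1_card card_ord.
subst n; split.
- by move=> c G H; rewrite /mu tauD tauZ.
- exact: (tau_bij_v K_distinct F_coefs tau_F).
- by move=> G _; apply: (tens_deg_tau K_distinct F_coefs tau_F).
- by move=> G H; rewrite /mu tauM.
Qed.
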